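(* The only $4$-dimensional real Lie algebra admitting a non-K\''ahler left-invariant $\mathcal{AH}_1$-structure $(g,J,\omega)$ is the Lie algebra $\mathcal{A}_{3,6}\oplus\mathcal{A}_1$ endowed with a flat Riemannian metric $g$ and a (non-K\''ahler) almost complex structure $J$ compatible with this metric.
   Context: An almost Hermitian structure $(g,J,\omega)$ on a $4$-dimensional Lie algebra $\mathfrak g$ is an inner product $g$, a $g$-orthogonal almost complex structure $J$ and $\omega(X,Y)=g(JX,Y)$, identified with the corresponding left-invariant structure on the associated simply connected Lie group. It is an $\mathcal{AH}_1$-structure if its Riemannian curvature tensor satisfies Gray's first condition $R_{XYZW}=R_{XYJZJW}$ for all $X,Y,Z,W$. It is K\''ahler if $\nabla J=0$, $\nabla$ being the Levi-Civita connection. $\mathcal{A}_{3,6}\oplus\mathcal{A}_1$ is the Lie algebra with basis $e_1,e_2,e_3,e_4$ whose only nonzero brackets (up to antisymmetry) are $[e_1,e_3]=-e_2$, $[e_2,e_3]=e_1$. *)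

(* Defs.v *)
From HB Require Import structures.
From mathcomp Require Import all_boot all_order all_algebra.
From mathcomp Require Import reals.
From mathcomp Require Import ring lra.

Set Implicit Arguments.
Unset Strict Implicit.
Unset Printing Implicit Defensive.

Import Order.TTheory GRing.Theory Num.Theory.
Local Open Scope ring_scope.

HB.mixin Record Vector_isLie (R : fieldType) (V : Type) of Vector R V := {
  liebr : V -> V -> V;
  liebr_linearl : forall y, linear (liebr ^~ y);
  liebr_linearr : forall x, linear (liebr x);
  liebrxx : forall x, liebr x x = 0;
  liebr_jacobi : forall x y z,
    liebr x (liebr y z) + liebr y (liebr z x) + liebr z (liebr x y) = 0
}.

#[short(type="lieAlgType")]
HB.structure Definition LieAlgebra (R : fieldType) :=
  { V of Vector_isLie R V & Vector R V }.

Notation "[< x , y >]" := (liebr x y)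
  (at level 0, x at level 99, y at level 99, format "[< x ,  y >]") : ring_scope.

HB.instance Definition _ (R : fieldType) (L : lieAlgType R) :=
  bilinear_isBilinear.Build R L L L *:%R *:%R (@liebr R L)
    (liebr_linearl, liebr_linearr).

Lemma liebrC (R : fieldType) (L : lieAlgType R) (x y : L) :
  [< x, y >] = - [< y, x >].
Proof.
have := liebrxx (x + y).
rewrite linearDr 2!linearDl /= !liebrxx addr0 add0r.
by move/eqP; rewrite addrC addr_eq0 => /eqP.
Qed.

Definition lie_isomorphic (R : fieldType) (L L' : lieAlgType R) : Prop :=
  exists f : {linear L -> L'},
    bijective f /\ forall x y, f [< x, y >] = [< f x, f y >].

(* The Lie algebra A_{3,6} + A_1: R^4, with e_1, ..., e_4 the canonical basis
   (0-based here); the formula is the bilinear extension of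
   [e_1, e_3] = - e_2 and [e_2, e_3] = e_1, cf. A36A1_brE. *)
Definition A36A1 (R : fieldType) : Type := 'rV[R]_4.

Section A36A1.
Variable R : fieldType.

HB.instance Definition _ := Vector.on (A36A1 R).

Definition A36A1_br (x y : 'rV[R]_4) : 'rV[R]_4 :=
  let c (u : 'rV[R]_4) k := u ord0 (inord k) in
  (c x 1 * c y 2 - c x 2 * c y 1) *: delta_mx ord0 (inord 0)
  - (c x 0 * c y 2 - c x 2 * c y 0) *: delta_mx ord0 (inord 1).

Fact A36A1_linearl (y : A36A1 R) :
  linear (fun x : A36A1 R => A36A1_br x y : A36A1 R).
Proof. by move=> a u v; apply/rowP => i; rewrite !mxE; ring. Qed.

Fact A36A1_linearr (x : A36A1 R) :
  linear (A36A1_br x : A36A1 R -> A36A1 R).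
Proof. by move=> a u v; apply/rowP => i; rewrite !mxE; ring. Qed.

Fact A36A1_brxx (x : A36A1 R) : A36A1_br x x = 0 :> A36A1 R.
Proof. by apply/rowP => i; rewrite !mxE; ring. Qed.

Fact A36A1_jacobi (x y z : A36A1 R) :
  A36A1_br x (A36A1_br y z) + A36A1_br y (A36A1_br z x)
  + A36A1_br z (A36A1_br x y) = 0 :> A36A1 R.
Proof.
by apply/rowP => i; rewrite !mxE -!val_eqE /= !inordK //=; ring.
Qed.

HB.instance Definition _ := Vector_isLie.Build R (A36A1 R)
  A36A1_linearl A36A1_linearr A36A1_brxx A36A1_jacobi.

Let e k : A36A1 R := delta_mx ord0 (inord k.-1).

Lemma A36A1_brE :
  [/\ [< e 1, e 3 >] = - e 2, [< e 2, e 3 >] = e 1, [< e 1, e 2 >] = 0 &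
   forall k, (k < 4)%N -> [< e k, e 4 >] = 0].
Proof.
split=> [||| [|[|[|[|k]]]] // _]; apply/rowP => i;
  by rewrite !mxE -!val_eqE /= !inordK //=; ring.
Qed.

Lemma dim_A36A1 : \dim {:A36A1 R} = 4%N.
Proof. by rewrite dimvf. Qed.

End A36A1.

Section LeftInvariantGeometry.
Variables (R : realType) (L : lieAlgType R).

Section Metric.
Variable g : {dot L for idfun}.

Definition musical : 'Hom(L, 'Hom(L, R^o)) :=
  linfun (fun X : L => linfun (fun Y : L => g X Y : R^o)).

(* On left-invariant fields the functions g(X, Y) are constant, so that the
   Koszul formula for 2 g(nabla_X Y, Z) reduces to its bracket terms. *)
Definition koszul (X Y Z : L) : R :=
  g [< X, Y >] Z - g [< Y, Z >] X + g [< Z, X >] Y.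

Definition levi_civita (X Y : L) : L :=
  (musical^-1)%VF (linfun (fun Z : L => koszul X Y Z / 2 : R^o)).

Definition riemann (X Y Z : L) : L :=
  levi_civita X (levi_civita Y Z) - levi_civita Y (levi_civita X Z)
  - levi_civita [< X, Y >] Z.

Definition curv (X Y Z W : L) : R := g (riemann X Y Z) W.

Definition flat : Prop := forall X Y Z : L, riemann X Y Z = 0.

Fact dotC (X Y : L) : g X Y = g Y X.
Proof. by rewrite (@hermitian_subproof _ _ _ _ g) expr0 mul1r. Qed.

Fact dotDr X : {morph g X : Y Z / Y + Z}. Proof. exact: raddfD. Qed.
Fact dotZr X a Y : g X (a *: Y) = a * g X Y.
Proof. exact: (@linearr_subproof _ _ _ _ _ _ g X a Y). Qed.
Fact dotDl X Y Z : g (X + Y) Z = g X Z + g Y Z.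
Proof. by rewrite dotC dotDr dotC (dotC Z). Qed.
Fact dotZl X a Y : g (a *: X) Y = a * g X Y.
Proof. by rewrite dotC dotZr dotC. Qed.
Fact dotNl X Y : g (- X) Y = - g X Y.
Proof. by rewrite -scaleN1r dotZl mulN1r. Qed.

Fact dot_inj X X' : (forall Y, g X Y = g X' Y) -> X = X'.
Proof.
move=> eqg; apply/eqP; rewrite -subr_eq0; apply/negPn/negP => n0.
have := neq0_dnorm_gt0 (s := g) _ n0.
by rewrite dotDl dotNl eqg subrr ltxx.
Qed.

Fact musicalE X Y : musical X Y = g X Y.
Proof.
have lr Z : linear (fun Y : L => g Z Y : R^o).
  by move=> a u v; rewrite dotDr dotZr.
pose fr Z : {linear L -> R^o} :=
  HB.pack (fun Y : L => g Z Y : R^o) (GRing.isLinear.Build _ _ _ _ _ (lr Z)).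
have frE Z : linfun (fun Y : L => g Z Y : R^o) = linfun (fr Z) by [].
have ll : linear (fun X : L => linfun (fun Y : L => g X Y : R^o)).
  move=> a u v; apply/lfunP => Z; rewrite !frE lfunE add_lfunE scale_lfunE.
  by rewrite !lfunE /= dotDl dotZl.
pose fl : {linear L -> 'Hom(L, R^o)} :=
  HB.pack (fun X : L => linfun (fun Y : L => g X Y : R^o))
    (GRing.isLinear.Build _ _ _ _ _ ll).
rewrite /musical -[linfun _]/(linfun fl) lfunE /=.
by rewrite -[linfun _]/(linfun (fr X)) lfunE.
Qed.

Lemma levi_civitaE X Y Z : g (levi_civita X Y) Z = koszul X Y Z / 2.
Proof.
have lk : linear (fun Z : L => koszul X Y Z / 2 : R^o).
  move=> a u v; rewrite /koszul liebr_linearr (liebr_linearl X a).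
  by rewrite !dotDl !dotDr !dotZl !dotZr /GRing.scale /=; ring.
pose f : {linear L -> R^o} :=
  HB.pack (fun Z : L => koszul X Y Z / 2 : R^o)
    (GRing.isLinear.Build _ _ _ _ _ lk).
have ker0 : lker musical == 0%VS.
  apply/lker0P => U V eqUV; apply: dot_inj => W.
  by rewrite -!musicalE eqUV.
have lim : limg musical = fullv.
  apply/eqP; rewrite eqEdim subvf /= limg_dim_eq; last first.
    by rewrite (eqP ker0) capv0.
  by rewrite !dimvf /= /dim /= muln1.
rewrite -musicalE /levi_civita limg_lfunVK ?lim ?memvf //.
by rewrite -[linfun _]/(linfun f) lfunE.
Qed.

(* levi_civita is the unique torsion-free metric left-invariant connection. *)
Lemma levi_civita_torsion X Y :
  levi_civita X Y - levi_civita Y X = [< X, Y >].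
Proof.
apply: dot_inj => Z; rewrite dotDl dotNl !levi_civitaE /koszul.
rewrite (liebrC Y X) (liebrC X Z) (liebrC Z Y) !dotNl; lra.
Qed.

Lemma levi_civita_metric X Y Z :
  g (levi_civita X Y) Z + g Y (levi_civita X Z) = 0.
Proof.
rewrite (dotC Y) !levi_civitaE /koszul.
rewrite (liebrC X Z) (liebrC Y X) (liebrC Z Y) !dotNl; lra.
Qed.

Lemma levi_civita_unique (nabla : L -> L -> L) :
  (forall X Y, nabla X Y - nabla Y X = [< X, Y >]) ->
  (forall X Y Z, g (nabla X Y) Z + g Y (nabla X Z) = 0) ->
  forall X Y, nabla X Y = levi_civita X Y.
Proof.
move=> tf mt X Y; apply: dot_inj => Z; rewrite levi_civitaE /koszul -!tf.
rewrite !dotDl !dotNl.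
have := mt X Y Z; have := mt Y Z X; have := mt Z X Y.
rewrite (dotC Y) (dotC Z) (dotC X); lra.
Qed.

End Metric.

Record almost_hermitian := AlmostHermitian {
  ah_metric : {dot L for idfun};
  ah_J : 'End(L);
  ah_form : L -> L -> R;
  ah_JJ : forall X, ah_J (ah_J X) = - X;
  ah_orthogonal : forall X Y, ah_metric (ah_J X) (ah_J Y) = ah_metric X Y;
  ah_formE : forall X Y, ah_form X Y = ah_metric (ah_J X) Y
}.

Implicit Type S : almost_hermitian.

Definition AH1 S : Prop := forall X Y Z W : L,
  curv (ah_metric S) X Y Z W = curv (ah_metric S) X Y (ah_J S Z) (ah_J S W).

(* nabla J = 0, as (nabla_X J) Y = nabla_X (J Y) - J (nabla_X Y). *)
Definition kahler S : Prop := forall X Y : L,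
  levi_civita (ah_metric S) X (ah_J S Y)
  - ah_J S (levi_civita (ah_metric S) X Y) = 0.

End LeftInvariantGeometry.

(* Main.v *)
Require Import Defs.
From HB Require Import structures.
From mathcomp Require Import all_boot all_order all_algebra.
From mathcomp Require Import reals.
From mathcomp Require Import ring lra.

(** Let e0, e1 = J e0, e2, e3 = J e2 be an orthonormal frame of L.  The
Levi-Civita connection is a one-form with values in so(4) = so(3) + so(3); its
self-dual half consists of three linear forms th1, th2, th3 on L ([sdf1],
[sdf2], [sdf3]), where th1 rotates the plane orthogonal to omega in the bundle
of self-dual forms, and th2, th3 are the components of nabla J.  Hence the
structure is Kaehler if and only if th2 = th3 = 0 (one implication is
[kahler_of_sdf]).  Gray's condition says that the curvature endomorphisms commute with
J, i.e. that two of the three components of the self-dual curvature vanish: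
  th2 [X, Y] = (th3 /\ th1)(X, Y),   th3 [X, Y] = (th1 /\ th2)(X, Y)
([AH_sdf2], [AH_sdf3]).  Write t = d th1 up to sign, t(X, Y) = th1 [X, Y].

The forms th1, th2, th3 depend on the frame only through the induced basis of
self-dual two-forms, and every unit vector can be moved to the position e0
without changing that basis ([frame_through]).  So, if the structure is not
Kaehler, one may assume that th2 is a nonzero multiple of the dual of e0
([frame_sdf2]).

If th2 and th3 are independent, the Jacobi identity applied to the two equations
above gives th2 /\ t = th3 /\ t = 0, hence t = k th2 /\ th3
([dsdf1_decomposable]), and the third curvature component is
(1 - k) th2 /\ th3.  By the pair symmetry of the curvature it is of type (1,1)
([AH_type11]).
- If k = 1, the self-dual connection is flat and th = (th1, th2, th3) is a Lie
  algebra morphism to so(3).  Expressing th by the structure constants in a frame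
  with e0 in the kernel of th yields th2 /\ th3 = 0 ([no_flat]).
- If k <> 1, the plane spanned by th2 and th3 is J-invariant, and the structure
  equations together with the Jacobi identity are inconsistent ([no_line]).
This is [rank1_of_normalized].

Thus th2 and th3 are proportional; the two equations then make th1 proportional
to them as well, so that all three are multiples of the dual of e0 and e0^perp
is an ideal.  The trace of the condition that ad e0 be a derivation of this ideal
is an equality between quadratic forms which, by the Cauchy-Schwarz inequality,
has only the zero solution: the ideal is abelian and ad e0 is skew
([rank1_abelian]).  Such a metric is flat, since nabla_X = g(X, e0) ad e0
([rotational_flat]), and the Lie algebra is A_{3,6} + A_1 ([iso_of_axis]).

Conversely flat metrics satisfy Gray's condition trivially, and the standard
metric of A_{3,6} + A_1 with J e_1 = e_3, J e_2 = e_4 is flat and not Kaehler. *)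

Set Implicit Arguments.
Unset Strict Implicit.
Unset Printing Implicit Defensive.
Import Order.TTheory GRing.Theory Num.Theory.
Local Open Scope ring_scope.

(** * Three-dimensional linear algebra *)

(** The determinant of a matrix of size three given by its entries. *)
Definition det3 (R : comRingType) (t11 t12 t13 t21 t22 t23 t31 t32 t33 : R) : R :=
  t11 * (t22 * t33 - t23 * t32) + t12 * (t23 * t31 - t21 * t33)
  + t13 * (t21 * t32 - t22 * t31).

Lemma cramer3 (F : fieldType) (t11 t12 t13 t21 t22 t23 t31 t32 t33 v1 v2 v3 : F) :
  det3 t11 t12 t13 t21 t22 t23 t31 t32 t33 != 0 ->
  t11 * v1 + t12 * v2 + t13 * v3 = 0 ->
  t21 * v1 + t22 * v2 + t23 * v3 = 0 ->
  t31 * v1 + t32 * v2 + t33 * v3 = 0 -> [/\ v1 = 0, v2 = 0 & v3 = 0].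
Proof.
move=> d0 e1 e2 e3.
have z a b c : a * (t11 * v1 + t12 * v2 + t13 * v3)
    + b * (t21 * v1 + t22 * v2 + t23 * v3)
    + c * (t31 * v1 + t32 * v2 + t33 * v3) = 0.
  by rewrite e1 e2 e3 !mulr0 !addr0.
split; apply: (mulfI d0); rewrite mulr0 /det3.
- by rewrite -[RHS](z (t22 * t33 - t23 * t32) (t32 * t13 - t33 * t12)
    (t12 * t23 - t13 * t22)); ring.
- by rewrite -[RHS](z (t23 * t31 - t21 * t33) (t33 * t11 - t31 * t13)
    (t13 * t21 - t11 * t23)); ring.
- by rewrite -[RHS](z (t21 * t32 - t22 * t31) (t31 * t12 - t32 * t11)
    (t11 * t22 - t12 * t21)); ring.
Qed.

(** Let T and S be real matrices of size three with T S^T = cof T, where cof T,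
with entries kij, is the cofactor matrix of T.  This is the shape taken by the
equation that makes a linear map T a morphism from a Lie algebra with structure
constants [ej, ek] = \sum_a S_ia ea, (i, j, k) cyclic, to so(3). *)
Section FlatSo3.
Variable R : realFieldType.
Variables t11 t12 t13 t21 t22 t23 t31 t32 t33 : R.
Variables s11 s12 s13 s21 s22 s23 s31 s32 s33 : R.

Let k11 := t22 * t33 - t23 * t32.
Let k12 := t23 * t31 - t21 * t33.
Let k13 := t21 * t32 - t22 * t31.
Let k21 := t32 * t13 - t33 * t12.
Let k22 := t33 * t11 - t31 * t13.
Let k23 := t31 * t12 - t32 * t11.
Let k31 := t12 * t23 - t13 * t22.
Let k32 := t13 * t21 - t11 * t23.
Let k33 := t11 * t22 - t12 * t21.
Let d := det3 t11 t12 t13 t21 t22 t23 t31 t32 t33.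

Let cof_unit : d != 0 -> det3 k11 k12 k13 k21 k22 k23 k31 k32 k33 != 0.
Proof.
move=> d0; have -> : det3 k11 k12 k13 k21 k22 k23 k31 k32 k33 = d ^+ 2.
  by rewrite /d /det3 /k11 /k12 /k13 /k21 /k22 /k23 /k31 /k32 /k33; ring.
by rewrite expf_neq0.
Qed.

Hypothesis e11 : t11 * s11 + t12 * s12 + t13 * s13 = k11.
Hypothesis e12 : t11 * s21 + t12 * s22 + t13 * s23 = k12.
Hypothesis e13 : t11 * s31 + t12 * s32 + t13 * s33 = k13.
Hypothesis e21 : t21 * s11 + t22 * s12 + t23 * s13 = k21.
Hypothesis e22 : t21 * s21 + t22 * s22 + t23 * s23 = k22.
Hypothesis e23 : t21 * s31 + t22 * s32 + t23 * s33 = k23.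
Hypothesis e31 : t31 * s11 + t32 * s12 + t33 * s13 = k31.
Hypothesis e32 : t31 * s21 + t32 * s22 + t33 * s23 = k32.
Hypothesis e33 : t31 * s31 + t32 * s32 + t33 * s33 = k33.

(** The sum of the squares of the cofactors is the trace of
(cof T)^T T S^T = (det T) S^T. *)
Lemma cof0_of_det0 : d = 0 -> [/\ k11 = 0, k12 = 0 & k13 = 0].
Proof.
move=> d0.
have sq0 (a b c : R) : a * a + b * b + c * c = 0 -> a = 0.
  move=> h; apply/eqP; rewrite -sqrf_eq0 eq_le sqr_ge0 andbT.
  have := (sqr_ge0 b, sqr_ge0 c) => -[]; lra.
split.
- apply: (@sq0 _ k21 k31); rewrite -{2}e11 -{2}e21 -{2}e31.
  transitivity (d * s11); last by rewrite d0 mul0r.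
  by rewrite /d /det3 /k11 /k21 /k31; ring.
- apply: (@sq0 _ k22 k32); rewrite -{2}e12 -{2}e22 -{2}e32.
  transitivity (d * s22); last by rewrite d0 mul0r.
  by rewrite /d /det3 /k12 /k22 /k32; ring.
- apply: (@sq0 _ k23 k33); rewrite -{2}e13 -{2}e23 -{2}e33.
  transitivity (d * s33); last by rewrite d0 mul0r.
  by rewrite /d /det3 /k13 /k23 /k33; ring.
Qed.

(** T S^T T^T = (det T) 1 is symmetric. *)
Lemma sym_of_det : d != 0 -> [/\ s12 = s21, s13 = s31 & s23 = s32].
Proof.
move=> d0.
have := @cramer3 _ _ _ _ _ _ _ _ _ _ (s23 - s32) (s31 - s13) (s12 - s21)
  (cof_unit d0).
have f1 : k11 * (s23 - s32) + k12 * (s31 - s13) + k13 * (s12 - s21) = 0.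
  transitivity ((k31 * t21 + k32 * t22 + k33 * t23) - (k21 * t31 + k22 * t32 + k23 * t33)).
    by rewrite -{1}e31 -{1}e32 -{1}e33 -{1}e21 -{1}e22 -{1}e23 /k11 /k12 /k13; ring.
  by rewrite /k21 /k22 /k23 /k31 /k32 /k33; ring.
have f2 : k21 * (s23 - s32) + k22 * (s31 - s13) + k23 * (s12 - s21) = 0.
  transitivity ((k11 * t31 + k12 * t32 + k13 * t33) - (k31 * t11 + k32 * t12 + k33 * t13)).
    by rewrite -{1}e11 -{1}e12 -{1}e13 -{1}e31 -{1}e32 -{1}e33 /k21 /k22 /k23; ring.
  by rewrite /k31 /k32 /k33 /k11 /k12 /k13; ring.
have f3 : k31 * (s23 - s32) + k32 * (s31 - s13) + k33 * (s12 - s21) = 0.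
  transitivity ((k21 * t11 + k22 * t12 + k23 * t13) - (k11 * t21 + k12 * t22 + k13 * t23)).
    by rewrite -{1}e21 -{1}e22 -{1}e23 -{1}e11 -{1}e12 -{1}e13 /k31 /k32 /k33; ring.
  by rewrite /k11 /k12 /k13 /k21 /k22 /k23; ring.
by case/(_ f1 f2 f3) => g1 g2 g3; split; lra.
Qed.

(** If moreover S l = 0 and T = (tr S) / 2 - S + [l], with [l] the skew matrix of
l, then cof T = 0.  When T is invertible, l = 0 and S is symmetric, so T is
symmetric with S = tr T - T and cof T = T (tr T - T); comparing traces gives
tr (cof T) = 0, and comparing entries then gives cof T = - cof T. *)
Lemma no_flat_so3 l1 l2 l3 :
  s11 * l1 + s12 * l2 + s13 * l3 = 0 ->
  s21 * l1 + s22 * l2 + s23 * l3 = 0 ->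
  s31 * l1 + s32 * l2 + s33 * l3 = 0 ->
  t11 = (s22 + s33 - s11) / 2 -> t22 = (s11 + s33 - s22) / 2 ->
  t33 = (s11 + s22 - s33) / 2 ->
  t12 = l3 - s12 -> t13 = - l2 - s13 -> t23 = l1 - s23 ->
  t21 = - l3 - s21 -> t31 = l2 - s31 -> t32 = - l1 - s32 ->
  [/\ k11 = 0, k12 = 0 & k13 = 0].
Proof.
move=> z1 z2 z3 q11 q22 q33 q12 q13 q23 q21 q31 q32.
have [/eqP|d0] := boolP (d == 0); first exact: cof0_of_det0.
have [y12 y13 y23] := sym_of_det d0.
have z a b c : a * (s11 * l1 + s12 * l2 + s13 * l3) + b * (s21 * l1 + s22 * l2 + s23 * l3)
   + c * (s31 * l1 + s32 * l2 + s33 * l3) = 0.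
  by rewrite z1 z2 z3 !mulr0 !addr0.
have [L1 L2 L3] : [/\ l1 = 0, l2 = 0 & l3 = 0].
  apply: (cramer3 (cof_unit d0)).
  - by rewrite -[RHS](z t11 t12 t13) -e11 -e12 -e13 -y12 -y13 -y23; ring.
  - by rewrite -[RHS](z t21 t22 t23) -e21 -e22 -e23 -y12 -y13 -y23; ring.
  - by rewrite -[RHS](z t31 t32 t33) -e31 -e32 -e33 -y12 -y13 -y23; ring.
have p12 : t12 = t21 by lra.
have p13 : t13 = t31 by lra.
have p23 : t23 = t32 by lra.
have a11 := e11; have a22 := e22; have a33 := e33; have a12 := e12; have a13 := e13.
have S11 : s11 = t22 + t33 by lra.
have S22 : s22 = t11 + t33 by lra.
have S33 : s33 = t11 + t22 by lra.
have S12 : s12 = - t12 by lra.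
have S13 : s13 = - t13 by lra.
have S23 : s23 = - t23 by lra.
rewrite -y12 -y13 -y23 S11 S22 S33 S12 S13 S23 -p12 -p13 -p23 in a11 a22 a33 a12 a13.
rewrite /k11 /k22 /k33 /k12 /k13 -p12 -p13 -p23 in a11 a22 a33 a12 a13 *.
split; lra.
Qed.
End FlatSo3.

(** * Structure constants in an orthonormal frame *)

(** Throughout, c i j k = g([ei, ej], ek) for an orthonormal frame e0, ..., e3;
only the indices below 4 matter. *)
Section StructureConstants.
Variables (R : realFieldType) (c : nat -> nat -> nat -> R).

(** The connection coefficient g(nabla_ei ej, ek), by the Koszul formula. *)
Definition conn i j k : R := (c i j k - c j k i + c k i j) / 2.
(** The values on ea of the three self-dual components of the connection, with
respect to e01 + e23, e02 + e31 and e03 + e12. *)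
Definition sd1 a : R := conn a 0 1 + conn a 2 3.
Definition sd2 a : R := conn a 0 2 + conn a 3 1.
Definition sd3 a : R := conn a 0 3 + conn a 1 2.

(** The em-component of the Jacobi identity for ei, ej, ek. *)
Definition jac i j k m : R :=
  (c j k 0 * c i 0 m + c j k 1 * c i 1 m + c j k 2 * c i 2 m + c j k 3 * c i 3 m)
  + (c k i 0 * c j 0 m + c k i 1 * c j 1 m + c k i 2 * c j 2 m + c k i 3 * c j 3 m)
  + (c i j 0 * c k 0 m + c i j 1 * c k 1 m + c i j 2 * c k 2 m + c i j 3 * c k 3 m).

Hypothesis cC : forall i j k, c i j k = - c j i k.
Hypothesis cJ : forall i j k m, jac i j k m = 0.

Lemma cxx i k : c i i k = 0.
Proof. have := cC i i k; lra. Qed.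

(** Rewriting rules expressing every structure constant by the c i j k with
i < j. *)
Definition cN := (cxx, cC 1 0, cC 2 0, cC 3 0, cC 2 1, cC 3 1, cC 3 2).

(** The linear form f, given by its values on the frame, evaluated on [ei, ej];
this is minus its exterior derivative. *)
Definition ext (f : nat -> R) i j : R :=
  c i j 0 * f 0 + c i j 1 * f 1 + c i j 2 * f 2 + c i j 3 * f 3.

Definition wedge (f g : nat -> R) i j : R := f i * g j - f j * g i.

(** There is no flat self-dual connection with th2 /\ th3 <> 0: if th is a
morphism to so(3) that kills e0, and if it is onto, then R e0 is an ideal, on
which L acts by a character l, and [no_flat_so3] applies. *)
Lemma no_flat :
  (forall i j, ext sd1 i j = wedge sd2 sd3 i j) ->
  (forall i j, ext sd2 i j = wedge sd3 sd1 i j) ->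
  (forall i j, ext sd3 i j = wedge sd1 sd2 i j) ->
  sd1 0 = 0 -> sd2 0 = 0 -> sd3 0 = 0 ->
  [/\ wedge sd2 sd3 2 3 = 0, wedge sd2 sd3 3 1 = 0 & wedge sd2 sd3 1 2 = 0].
Proof.
move=> F1 F2 F3 z1 z2 z3.
pose d := det3 (sd1 1) (sd1 2) (sd1 3) (sd2 1) (sd2 2) (sd2 3) (sd3 1) (sd3 2) (sd3 3).
have E f i j : f 0 = 0 -> f 1 * c i j 1 + f 2 * c i j 2 + f 3 * c i j 3 = ext f i j.
  by rewrite /ext => ->; ring.
have d_case : d = 0 \/ forall j, [/\ c 0 j 1 = 0, c 0 j 2 = 0 & c 0 j 3 = 0].
  have [/eqP|d0] := boolP (d == 0); [by left|right=> j].
  apply: (cramer3 d0); rewrite E // ?F1 ?F2 ?F3 /wedge ?z1 ?z2 ?z3; ring.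
case: d_case => [d0|c0].
  by apply: (@cof0_of_det0 _ (sd1 1) (sd1 2) (sd1 3) (sd2 1) (sd2 2) (sd2 3) (sd3 1)
    (sd3 2) (sd3 3) (c 2 3 1) (c 2 3 2) (c 2 3 3) (c 3 1 1) (c 3 1 2) (c 3 1 3)
    (c 1 2 1) (c 1 2 2) (c 1 2 3)) => //; rewrite E // ?F1 ?F2 ?F3 /wedge //; ring.
have [c011 c012 c013] := c0 1; have [c021 c022 c023] := c0 2; have [c031 c032 c033] := c0 3.
have cZ := (c011, c012, c013, c021, c022, c023, c031, c032, c033).
have h1 := z1; have h2 := z2; have h3 := z3.
rewrite /sd1 /sd2 /sd3 /conn !cN !cZ in h1 h2 h3.
apply: (@no_flat_so3 _ (sd1 1) (sd1 2) (sd1 3) (sd2 1) (sd2 2) (sd2 3) (sd3 1)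
    (sd3 2) (sd3 3) (c 2 3 1) (c 2 3 2) (c 2 3 3) (c 3 1 1) (c 3 1 2) (c 3 1 3)
    (c 1 2 1) (c 1 2 2) (c 1 2 3) _ _ _ _ _ _ _ _ _ (c 1 0 0) (c 2 0 0) (c 3 0 0)).
1-9: by rewrite E // ?F1 ?F2 ?F3 /wedge //; ring.
1-3: rewrite !cN.
- by have := cJ 0 2 3 0; rewrite /jac !cN !cZ; lra.
- by have := cJ 0 1 3 0; rewrite /jac !cN !cZ; lra.
- by have := cJ 0 1 2 0; rewrite /jac !cN !cZ; lra.
all: rewrite /sd1 /sd2 /sd3 /conn !cN ?cZ; lra.
Qed.

(** Let the self-dual connection be a multiple of the dual of e0, and let
h = span(e1, e2, e3) be an ideal.  With [ej, ek] = \sum_a S_ia ea on h and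
D = ad e0, the hypotheses on sd1, sd2, sd3 say that S is symmetric and that the
symmetric part of D is (tr S) / 2 - S; the trace of the derivation property
of D then reads 4 tr (S^2) = (tr S)^2, which forces S = 0. *)
Lemma rank1_abelian : (forall i j, c i j 0 = 0) ->
  (forall a, (0 < a < 4)%N -> [/\ sd1 a = 0, sd2 a = 0 & sd3 a = 0]) ->
  [/\ forall k, (k < 4)%N -> [/\ c 1 2 k = 0, c 2 3 k = 0 & c 3 1 k = 0],
      [/\ c 0 1 1 = 0, c 0 2 2 = 0 & c 0 3 3 = 0] &
      [/\ c 0 2 1 = - c 0 1 2, c 0 3 2 = - c 0 2 3 & c 0 1 3 = - c 0 3 1]].
Proof.
move=> c0 sd0.
have [h11 h12 h13] := sd0 1 isT; have [h21 h22 h23] := sd0 2 isT.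
have [h31 h32 h33] := sd0 3 isT.
have j1 := cJ 0 2 3 1; have j2 := cJ 0 3 1 2; have j3 := cJ 0 1 2 3.
rewrite /sd1 /sd2 /sd3 /conn /jac in h11 h12 h13 h21 h22 h23 h31 h32 h33 j1 j2 j3.
rewrite !cN !c0 in h11 h12 h13 h21 h22 h23 h31 h32 h33 j1 j2 j3.
have s12 : c 1 3 1 = - c 2 3 2 by lra.
have s13 : c 1 2 1 = c 2 3 3 by lra.
have s23 : c 1 2 2 = - c 1 3 3 by lra.
have d11 : c 0 1 1 = (c 1 2 3 - c 1 3 2 - c 2 3 1) / 2 by lra.
have d22 : c 0 2 2 = (c 1 2 3 + c 1 3 2 + c 2 3 1) / 2 by lra.
have d33 : c 0 3 3 = (- c 1 2 3 - c 1 3 2 + c 2 3 1) / 2 by lra.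
have d21 : c 0 2 1 = - 2 * c 2 3 2 - c 0 1 2 by lra.
have d31 : c 0 3 1 = - 2 * c 2 3 3 - c 0 1 3 by lra.
have d32 : c 0 3 2 = 2 * c 1 3 3 - c 0 2 3 by lra.
(* The sum of the diagonal components of the derivation property of D. *)
have trJ : 4 * (c 2 3 1 ^+ 2 + c 1 3 2 ^+ 2 + c 1 2 3 ^+ 2
    + 2 * (c 2 3 2 ^+ 2 + c 2 3 3 ^+ 2 + c 1 3 3 ^+ 2))
    = (c 2 3 1 - c 1 3 2 + c 1 2 3) ^+ 2.
  rewrite s12 s13 s23 d11 d22 d33 d21 d31 d32 in j1 j2 j3; lra.
(* 3 tr (S^2) - (tr S)^2 is a sum of squares. *)
have sos : [/\ c 2 3 1 = 0, c 1 3 2 = 0 & c 1 2 3 = 0]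
    /\ [/\ c 2 3 2 = 0, c 2 3 3 = 0 & c 1 3 3 = 0].
  have := (sqr_ge0 (c 2 3 1 + c 1 3 2), sqr_ge0 (c 2 3 1 - c 1 2 3),
    sqr_ge0 (c 1 3 2 + c 1 2 3)).
  have := (sqr_ge0 (c 2 3 1), sqr_ge0 (c 1 3 2), sqr_ge0 (c 1 2 3)).
  have := (sqr_ge0 (c 2 3 2), sqr_ge0 (c 2 3 3), sqr_ge0 (c 1 3 3)).
  move=> [[g1 g2] g3] [[g4 g5] g6] [[g7 g8] g9].
  by split; split; apply/eqP; rewrite -sqrf_eq0 eq_le; apply/andP; split=> //; lra.
case: sos => -[s1 s2 s3] [s4 s5 s6]; clear trJ j1 j2 j3.
split; [|split; lra|split; lra].
by case=> [|[|[|[|[]]]]] // _; rewrite !cN; split; lra.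
Qed.

(** The algebraic core of [no_line].  The first two equations are a linear system
for (t2, t3) of determinant 4 - (Y + Z)^2.  When it is invertible, its solution
contradicts the third equation; Y + Z = - 2 contradicts the second equation, and
Y + Z = 2 gives the stated values. *)
Lemma nonflat_critical (F : realFieldType) (p X Y Z t2 t3 : F) : p != 0 -> Y * Z = 1 + X ^+ 2 ->
  2 * X * t3 + (Y - Z) * t2 + p * X = 0 ->
  2 * X * t2 - (Y - Z) * t3 + p - p * Y = 0 ->
  (2 - (Y + Z)) * (t2 ^+ 2 + t3 ^+ 2) + p * X * t2 - (p * Y + p) * t3 = 0 ->
  X = 0 /\ Y = 1.
Proof.
move=> p0 YZ E1 E2 E3.
have Y0 : Y != 0.
  by apply/negP => /eqP Y0; move: YZ; rewrite Y0 mul0r; have := sqr_ge0 X; lra.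
have XY : Y + Z = 2 -> X = 0 /\ Y = 1.
  move=> s2; have : X ^+ 2 + (Y - 1) ^+ 2 = 0.
    have -> : X ^+ 2 = Y * Z - 1 by lra.
    have -> : Z = 2 - Y by lra.
    by ring.
  move/eqP; rewrite paddr_eq0 ?sqr_ge0 // !sqrf_eq0 subr_eq0 => /andP[/eqP-> /eqP->].
  by [].
have [/eqP s2|s2] := boolP (Y + Z - 2 == 0); first by apply: XY; lra.
exfalso.
have T2 : t2 * (Y + Z + 2) = p * X.
  apply: (mulfI s2).
  transitivity ((Y - Z) * ((Y - Z) * t2 + 2 * X * t3) + 2 * X * (2 * X * t2 - (Y - Z) * t3)
    + 4 * (Y * Z - 1 - X ^+ 2) * t2); first ring.
  have -> : (Y - Z) * t2 + 2 * X * t3 = - p * X by lra.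
  have -> : 2 * X * t2 - (Y - Z) * t3 = p * Y - p by lra.
  by rewrite YZ; ring.
have T3 : t3 * (Y + Z + 2) = - p * (Y + 1).
  apply: (mulfI s2).
  transitivity (2 * X * ((Y - Z) * t2 + 2 * X * t3) - (Y - Z) * (2 * X * t2 - (Y - Z) * t3)
    + 4 * (Y * Z - 1 - X ^+ 2) * t3); first ring.
  have -> : (Y - Z) * t2 + 2 * X * t3 = - p * X by lra.
  have -> : 2 * X * t2 - (Y - Z) * t3 = p * Y - p by lra.
  have -> : Y * Z - 1 - X ^+ 2 = 0 by lra.
  transitivity (p * (- 2 * (X ^+ 2) - Y ^+ 2 + Y + Y * Z - Z)); first ring.
  have -> : X ^+ 2 = Y * Z - 1 by lra.
  by ring.
have [/eqP s0|s0] := boolP (Y + Z + 2 == 0).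
  move: T2 T3; rewrite s0 !mulr0 => /esym/eqP; rewrite mulf_eq0 (negPf p0) /= => /eqP X0.
  move/esym/eqP; rewrite mulf_eq0 oppr_eq0 (negPf p0) /= => /eqP Y1.
  have YZ0 : Y - Z = 0 by lra.
  have Ym : Y = - 1 by lra.
  move: E2; rewrite X0 YZ0 Ym => E2; move/eqP: p0; apply; lra.
have : (p ^+ 2 * Y) * 4 * (Y + Z + 2) = 0.
  transitivity ((Y + Z + 2) ^+ 2 * ((2 - (Y + Z)) * (t2 ^+ 2 + t3 ^+ 2) + p * X * t2 - (p * Y + p) * t3));
    last by rewrite E3 mulr0.
  transitivity ((2 - (Y + Z)) * ((t2 * (Y + Z + 2)) ^+ 2 + (t3 * (Y + Z + 2)) ^+ 2)
    + (Y + Z + 2) * (p * X * (t2 * (Y + Z + 2)) - (p * Y + p) * (t3 * (Y + Z + 2)))); last ring.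
  rewrite T2 T3.
  transitivity (p ^+ 2 * (2 - (Y + Z)) * (X ^+ 2 + (Y + 1) ^+ 2)
   + p ^+ 2 * (Y + Z + 2) * (X ^+ 2 + (Y + 1) ^+ 2)); last ring.
  have -> : X ^+ 2 = Y * Z - 1 by lra.
  ring.
by move/eqP; apply/negP; rewrite !mulf_neq0 ?expf_neq0 ?pnatr_eq0.
Qed.

(** The Gray equations and d th1 = - k th2 /\ th3 have no solution for which
th2 /\ th3 is a nonzero form of type (1,1), i.e. th2 = p e^0 and
th3 = x e^0 + y e^1 with p and y nonzero.  With X = x / p, Y = y / p
and t = th1, the two Gray equations give
  de^0 = - (X e^0 + Y e^1) /\ t,  de^1 = (Z e^0 + X e^1) /\ t,
where Y Z = 1 + X^2.  The definition of th in terms of the structure constants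
determines de^2 and de^3 up to two parameters, and imposes two linear conditions
on (t2, t3). *)
Lemma no_line k :
  (forall i j, ext sd1 i j = k * wedge sd2 sd3 i j) ->
  (forall i j, ext sd2 i j = wedge sd3 sd1 i j) ->
  (forall i j, ext sd3 i j = wedge sd1 sd2 i j) ->
  sd2 1 = 0 -> sd2 2 = 0 -> sd2 3 = 0 -> sd3 2 = 0 -> sd3 3 = 0 ->
  sd2 0 * sd3 1 = 0.
Proof.
move=> F1 F2 F3 z21 z22 z23 z32 z33.
apply/eqP; rewrite mulf_eq0 -[_ || _]negbK negb_or; apply/negP => /andP[p0 y0].
set p := sd2 0 in p0; set x := sd3 0; set y := sd3 1 in y0.
set t0 := sd1 0; set t1 := sd1 1; set t2 := sd1 2; set t3 := sd1 3.
pose X := x / p; pose Y := y / p; pose Z := (1 + X ^+ 2) / Y.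
have Y0 : Y != 0 by rewrite mulf_neq0 ?invr_neq0.
have xE : x = p * X by rewrite /X mulrC divfK.
have yE : y = p * Y by rewrite /Y mulrC divfK.
have YZ : Y * Z = 1 + X ^+ 2 by rewrite /Z mulrC divfK.
have A i j : p * c i j 0 = wedge sd3 sd1 i j.
  by rewrite -F2 /ext z21 z22 z23 /p; ring.
have B i j : x * c i j 0 + y * c i j 1 = wedge sd1 sd2 i j.
  by rewrite -F3 /ext z32 z33 /x /y; ring.
have cA i j u : wedge sd3 sd1 i j = p * u -> c i j 0 = u.
  by move=> h; apply: (mulfI p0); rewrite A.
have cB i j u : p * Y * u + p * X * c i j 0 = wedge sd1 sd2 i j -> c i j 1 = u.
  move=> h; apply: (mulfI y0); have := B i j; rewrite -h -xE -yE; lra.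
have c010 : c 0 1 0 = X * t1 - Y * t0.
  by apply: cA; rewrite /wedge -/x -/y -/t0 -/t1 xE yE; ring.
have c020 : c 0 2 0 = X * t2 by apply: cA; rewrite /wedge -/x z32 -/t0 -/t2 xE; ring.
have c030 : c 0 3 0 = X * t3 by apply: cA; rewrite /wedge -/x z33 -/t0 -/t3 xE; ring.
have c120 : c 1 2 0 = Y * t2 by apply: cA; rewrite /wedge -/y z32 -/t1 -/t2 yE; ring.
have c130 : c 1 3 0 = Y * t3 by apply: cA; rewrite /wedge -/y z33 -/t1 -/t3 yE; ring.
have c230 : c 2 3 0 = 0 by apply: cA; rewrite /wedge z32 z33; ring.
have pYZ u : p * Y * (- Z * u) = - p * (1 + X ^+ 2) * u by rewrite -YZ; ring.
have c011 : c 0 1 1 = - Z * t1 + X * t0.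
  apply: cB; rewrite c010 /wedge -/t0 -/t1 z21 -/p mulrDr pYZ; ring.
have c021 : c 0 2 1 = - Z * t2.
  apply: cB; rewrite c020 /wedge -/t0 -/t2 z22 -/p pYZ; ring.
have c031 : c 0 3 1 = - Z * t3.
  apply: cB; rewrite c030 /wedge -/t0 -/t3 z23 -/p pYZ; ring.
have c121 : c 1 2 1 = - X * t2.
  apply: cB; rewrite c120 /wedge z21 z22; ring.
have c131 : c 1 3 1 = - X * t3.
  apply: cB; rewrite c130 /wedge z21 z23; ring.
have c231 : c 2 3 1 = 0 by apply: cB; rewrite c230 /wedge z22 z23; ring.
have cE := (c010, c020, c030, c120, c130, c230, c011, c021, c031, c121, c131, c231).
have q10 : sd1 0 = t0 by []. have q11 : sd1 1 = t1 by [].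
have q12 : sd1 2 = t2 by []. have q13 : sd1 3 = t3 by [].
have q20 : sd2 0 = p by []. have q30 : sd3 0 = p * X by [].
have q31 : sd3 1 = p * Y by [].
have Z2 := (z21, z22, z23, z32, z33).
clearbody p x y t0 t1 t2 t3 X Y Z.
(* The coefficients of d th1 = - k th2 /\ th3 on the remaining basis two-vectors. *)
have G23 := F1 2 3; have G12 := F1 1 2; have G13 := F1 1 3.
have G02 := F1 0 2; have G03 := F1 0 3.
rewrite /ext /wedge !Z2 ?q10 ?q11 ?q12 ?q13 ?q20 ?q30 ?q31 ?cE in G23 G12 G13 G02 G03.
rewrite /sd1 /sd2 /sd3 /conn !cN !cE in q10 q11 q12 q13 q20 q30 q31 z21 z22 z23 z32 z33.
have a23 : 2 * c 2 3 2 = - ((2 - (Y + Z)) * t2 + p * X) by lra.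
have b23 : 2 * c 2 3 3 = - ((2 - (Y + Z)) * t3 - p * Y - p) by lra.
(* The e^23-component of d th1 vanishes. *)
have [X0 Y1] : X = 0 /\ Y = 1.
  apply: (@nonflat_critical R p X Y Z t2 t3) => //; first lra; first lra.
  transitivity (- (2 * c 2 3 2) * t2 - (2 * c 2 3 3) * t3); first by rewrite a23 b23; ring.
  lra.
have Z1 : Z = 1 by move: YZ; rewrite X0 Y1; lra.
rewrite X0 Y1 Z1 in G23 G12 G13 G02 G03 q10 q11 q12 q13 q20 q30 q31 z21 z22 z23 z32 z33 a23 b23 cE.
(* From here on th2 and th3 are orthogonal of the same length. *)
have t30 : t3 = 0.
  have c232 : c 2 3 2 = 0 by lra.
  have c233 : c 2 3 3 = p by lra.
  by apply: (mulfI p0); move: G23; rewrite c232 c233; lra.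
rewrite t30 in G12 G13 G02 G03 q10 q11 q12 q13 q20 q30 q31 z21 z22 z23 z32 z33 a23 b23 cE.
have c012 : c 0 1 2 = 0 by lra.
have c013 : c 0 1 3 = - 2 * p by lra.
have c232 : c 2 3 2 = 0 by lra.
have c233 : c 2 3 3 = p by lra.
have c033 : c 0 3 3 = - c 0 2 2 by lra.
have c133 : c 1 3 3 = - c 1 2 2 by lra.
have c132 : c 1 3 2 = c 0 2 2 by lra.
have c123 : c 1 2 3 = c 0 2 2 by lra.
have c032 : c 0 3 2 = - c 1 2 2 by lra.
have c023 : c 0 2 3 = - c 1 2 2 by lra.
pose cF := (c012, c013, c232, c233, c033, c133, c132, c123, c032, c023).
rewrite !cF in G12 G13 G02 G03.
(* The two free parameters are killed by d th1 if t2 <> 0, by Jacobi otherwise. *)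
have [c022 c122] : c 0 2 2 = 0 /\ c 1 2 2 = 0.
  have [/eqP t20|t20] := boolP (t2 == 0); last first.
    by split; apply: (mulfI t20); lra.
  have := cJ 0 2 3 2; have := cJ 1 2 3 2.
  rewrite /jac !cN !cE !cF t20 => J1 J0.
  by split; apply: (mulfI p0); lra.
have := cJ 0 1 2 3; rewrite /jac !cN !cE !cF c022 c122 => J.
by move/eqP: p0; apply; apply/eqP; rewrite -sqrf_eq0; apply/eqP; lra.
Qed.

End StructureConstants.

(** * The Levi-Civita connection and its curvature *)

Section LeftInvariant.
Variables (R : realType) (L : lieAlgType R) (g : {dot L for idfun}).
Implicit Types (X Y Z W : L) (a : R) (e : nat -> L).

Lemma dotNr X Y : g X (- Y) = - g X Y.
Proof. by rewrite dotC dotNl dotC. Qed.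
Lemma dotBl X Y Z : g (X - Y) Z = g X Z - g Y Z.
Proof. by rewrite dotDl dotNl. Qed.
Lemma dotBr X Y Z : g X (Y - Z) = g X Y - g X Z.
Proof. by rewrite dotDr dotNr. Qed.
Lemma dot0l X : g 0 X = 0.
Proof. by rewrite -[0 in LHS](scale0r X) dotZl mul0r. Qed.
Lemma dot0r X : g X 0 = 0.
Proof. by rewrite dotC dot0l. Qed.

Definition dotE := (dotDl, dotBl, dotNl, dotZl, dotDr, dotBr, dotNr, dotZr, dot0l, dot0r).

Lemma brDl X Y Z : [< X + Y, Z >] = [< X, Z >] + [< Y, Z >].
Proof. exact: linearDl. Qed.
Lemma brDr X Y Z : [< X, Y + Z >] = [< X, Y >] + [< X, Z >].
Proof. exact: linearDr. Qed.
Lemma brBl X Y Z : [< X - Y, Z >] = [< X, Z >] - [< Y, Z >].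
Proof. exact: linearBl. Qed.
Lemma brBr X Y Z : [< X, Y - Z >] = [< X, Y >] - [< X, Z >].
Proof. exact: linearBr. Qed.
Lemma brZl a X Z : [< a *: X, Z >] = a *: [< X, Z >].
Proof. exact: linearZl_LR. Qed.
Lemma brZr a X Z : [< X, a *: Z >] = a *: [< X, Z >].
Proof. exact: linearZr_LR. Qed.

Local Notation nabla := (levi_civita g).
Local Notation cv := (curv g).

Lemma lcDl X Y Z : nabla (X + Y) Z = nabla X Z + nabla Y Z.
Proof.
apply: (@dot_inj _ _ g) => W; rewrite dotDl !levi_civitaE /koszul.
by rewrite !brDl !brDr !dotE; lra.
Qed.
Lemma lcZl a X Z : nabla (a *: X) Z = a *: nabla X Z.
Proof.
apply: (@dot_inj _ _ g) => W; rewrite dotZl !levi_civitaE /koszul.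
by rewrite !brZl !brZr !dotE; lra.
Qed.
Lemma lcDr X Y Z : nabla X (Y + Z) = nabla X Y + nabla X Z.
Proof.
apply: (@dot_inj _ _ g) => W; rewrite dotDl !levi_civitaE /koszul.
by rewrite !brDl !brDr !dotE; lra.
Qed.
Lemma lcZr a X Z : nabla X (a *: Z) = a *: nabla X Z.
Proof.
apply: (@dot_inj _ _ g) => W; rewrite dotZl !levi_civitaE /koszul.
by rewrite !brZl !brZr !dotE; lra.
Qed.
Lemma lcNr X Z : nabla X (- Z) = - nabla X Z.
Proof. by rewrite -scaleN1r lcZr scaleN1r. Qed.
Lemma lcBr X Y Z : nabla X (Y - Z) = nabla X Y - nabla X Z.
Proof. by rewrite lcDr lcNr. Qed.

Lemma lc_skew X Y Z : g (nabla X Y) Z = - g (nabla X Z) Y.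
Proof. by have := levi_civita_metric g X Y Z; rewrite (dotC _ Y); lra. Qed.

(** The curvature in terms of the connection, as nabla_X is skew. *)
Lemma curvE X Y Z W : cv X Y Z W =
  g (nabla X Z) (nabla Y W) - g (nabla Y Z) (nabla X W) - g (nabla [< X, Y >] Z) W.
Proof.
rewrite /curv /riemann !dotBl (lc_skew X (nabla Y Z)) (lc_skew Y (nabla X Z)).
by rewrite (dotC _ (nabla X W)) (dotC _ (nabla Y W)); lra.
Qed.

Lemma curv_skewl X Y Z W : cv X Y Z W = - cv Y X Z W.
Proof.
rewrite !curvE (liebrC X Y) -[- [< Y, X >]]scaleN1r lcZl scaleN1r dotNl; lra.
Qed.

Lemma curv_skewr X Y Z W : cv X Y Z W = - cv X Y W Z.
Proof.
rewrite !curvE (lc_skew _ Z W) (dotC _ (nabla X Z)) (dotC _ (nabla Y Z)); lra.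
Qed.

Lemma bianchi X Y Z W : cv X Y Z W + cv Y Z X W + cv Z X Y W = 0.
Proof.
rewrite /curv /riemann !dotBl.
have t U V U' : g (nabla U (nabla V U')) W - g (nabla U (nabla U' V)) W
    = g (nabla U [< V, U' >]) W.
  by rewrite -dotBl -lcBr levi_civita_torsion.
have s U V : g (nabla U V) W - g (nabla V U) W = g [< U, V >] W.
  by rewrite -dotBl levi_civita_torsion.
have := congr1 (g^~ W) (liebr_jacobi X Y Z); rewrite /= !dotE.
have := (t X Y Z, t Y Z X, t Z X Y) => -[[]].
have := (s X [< Y, Z >], s Y [< Z, X >], s Z [< X, Y >]) => -[[]].
lra.
Qed.

Lemma curv_pair X Y Z W : cv X Y Z W = cv Z W X Y.
Proof.
have sw A B C D : cv A B C D = cv B A D C by rewrite curv_skewl curv_skewr opprK.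
have := (bianchi X Y Z W, bianchi Y Z W X, bianchi Z W X Y, bianchi W X Y Z) => -[[[]]].
rewrite (curv_skewr Y Z W X) (curv_skewr Z W Y X) (curv_skewl W Y Z X).
rewrite (sw W X Z Y) (sw X Z W Y) (curv_skewl W X Y Z) (curv_skewr X Y W Z).
rewrite (curv_skewr Y W X Z); lra.
Qed.

(** * Orthonormal frames *)

(** A frame is a sequence e : nat -> L of which only the first four terms matter. *)
Definition orthonormal4 e := forall i j, (i < 4)%N -> (j < 4)%N -> g (e i) (e j) = (i == j)%:R.

Lemma orthonormal_expand e X : \dim {: L} = 4%N -> orthonormal4 e ->
  X = g X (e 0) *: e 0%N + g X (e 1) *: e 1%N + g X (e 2) *: e 2%N + g X (e 3) *: e 3%N.
Proof.
move=> dimL on.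
have lf : linear (fun X => \row_(i < 4) g X (e i) : 'rV[R]_4).
  by move=> a u v; apply/rowP => i; rewrite !mxE dotDl dotZl.
pose f : {linear L -> 'rV[R]_4} :=
  HB.pack (fun X => \row_(i < 4) g X (e i) : 'rV[R]_4) (GRing.isLinear.Build _ _ _ _ _ lf).
have onE i j : (i < 4)%N -> (j < 4)%N -> g (e i) (e j) = (i == j)%:R by exact: on.
have fE (v : 'rV[R]_4) : f (\sum_(i < 4) v 0 i *: e i) = v.
  apply/rowP => j; rewrite mxE !big_ord_recl big_ord0 !dotE !onE //=.
  have jE : j = ord0 \/ j = lift ord0 ord0 \/ j = lift ord0 (lift ord0 ord0)
    \/ j = lift ord0 (lift ord0 (lift ord0 ord0)).
    by case: j => [[|[|[|[|]]]]] // lt_j; [left|right;left|right;right;left|right;right;right];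
      apply: val_inj.
  by case: jE => [|[|[|]]] -> /=; rewrite !(mulr0, mulr1, addr0, add0r).
have lim : limg (linfun f) = fullv.
  apply/eqP; rewrite eqEsubv subvf; apply/subvP => v _.
  by rewrite -[v]fE -[f _]lfunE memv_img ?memvf.
have ker0 : lker (linfun f) == 0%VS.
  have := limg_ker_dim (linfun f) fullv; rewrite lim !dimvf /dim /= in dimL *.
  by rewrite dimL capfv mul1n => h; rewrite -dimv_eq0 -(eqn_add2r 4) h.
move/lker0P: ker0; apply; rewrite !lfunE /=.
rewrite -[LHS]fE !big_ord_recl big_ord0 !mxE /= addr0 !addrA.
by [].
Qed.

Lemma dot_gt0 X : X != 0 -> 0 < g X X.
Proof. exact: neq0_dnorm_gt0. Qed.

Lemma unit_scale X : X != 0 -> exists2 a, a != 0 & g (a *: X) (a *: X) = 1.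
Proof.
move=> X0; have gX := dot_gt0 X0.
exists (Num.sqrt (g X X))^-1; first by rewrite invr_neq0 // sqrtr_eq0 -ltNge.
by rewrite !dotE mulrA -invfM -expr2 sqr_sqrtr ?ltW // mulVf ?gt_eqF.
Qed.

Lemma exists_unit_ker (f1 f2 f3 : L -> R) : \dim {: L} = 4%N ->
  linear (f1 : L -> R^o) -> linear (f2 : L -> R^o) -> linear (f3 : L -> R^o) ->
  exists u, [/\ g u u = 1, f1 u = 0, f2 u = 0 & f3 u = 0].
Proof.
move=> dimL l1 l2 l3.
pose F X : 'rV[R]_3 := \row_(i < 3) [:: f1 X; f2 X; f3 X]`_i.
have lf : linear F.
  move=> a u v; apply/rowP => -[[|[|[|]]] // lt3]; rewrite !mxE /=.
  - exact: l1.
  - exact: l2.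
  - exact: l3.
pose f : {linear L -> 'rV[R]_3} := HB.pack F (GRing.isLinear.Build _ _ _ _ _ lf).
pose v := vpick (lker (linfun f)).
have v0 : v != 0.
  rewrite vpick0 -dimv_eq0; apply/eqP => k0.
  have := limg_ker_dim (linfun f) fullv; rewrite capfv k0 dimL add0n => d4.
  by have := dimvS (subvf (limg (linfun f))); rewrite d4 dimvf /dim.
have : f v = 0 by have := memv_pick (lker (linfun f)); rewrite memv_ker lfunE => /eqP.
move=> /rowP fv; have [a a0 av] := unit_scale v0.
have z h : linear (h : L -> R^o) -> h v = 0 -> h (a *: v) = 0.
  move=> lh hv; have := lh a v 0; rewrite addr0 => ->; rewrite hv scaler0 add0r.
  by have := lh (-1) 0 0; rewrite scaler0 addr0 scaleN1r addNr.
exists (a *: v); split => //; apply: z => //.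
- by have := fv (inord 0); rewrite !mxE inordK.
- by have := fv (inord 1); rewrite !mxE inordK.
- by have := fv (inord 2); rewrite !mxE inordK.
Qed.

(** Frames adapted to J: orthonormal, with e1 = J e0 and e3 = J e2. *)
Definition adapted (J : 'End(L)) e :=
  [/\ orthonormal4 e, J (e 0) = e 1%N & J (e 2) = e 3%N].

(** The self-dual part of the Levi-Civita connection, as three linear forms on L;
it refers to the basis e01 + e23, e02 + e31, e03 + e12 of self-dual two-forms. *)
Definition sdf1 e X : R := g (nabla X (e 0)) (e 1) + g (nabla X (e 2)) (e 3).
Definition sdf2 e X : R := g (nabla X (e 0)) (e 2) + g (nabla X (e 3)) (e 1).
Definition sdf3 e X : R := g (nabla X (e 0)) (e 3) + g (nabla X (e 1)) (e 2).

Lemma linear_dot Y : linear (g^~ Y : L -> R^o).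
Proof. by move=> a u v; rewrite /= !dotE. Qed.

Lemma orthonormal4P e :
  [/\ g (e 0) (e 0) = 1, g (e 1) (e 1) = 1, g (e 2) (e 2) = 1 & g (e 3) (e 3) = 1] ->
  [/\ g (e 0) (e 1) = 0, g (e 0) (e 2) = 0 & g (e 0) (e 3) = 0] ->
  [/\ g (e 1) (e 2) = 0, g (e 1) (e 3) = 0 & g (e 2) (e 3) = 0] -> orthonormal4 e.
Proof.
move=> [h00 h11 h22 h33] [h01 h02 h03] [h12 h13 h23].
by case=> [|[|[|[|]]]] // [|[|[|[|]]]] // _ _; rewrite // dotC.
Qed.

Lemma adapted_exists (J : 'End(L)) : \dim {: L} = 4%N ->
  (forall X, J (J X) = - X) -> (forall X Y, g (J X) (J Y) = g X Y) ->
  exists e, adapted J e.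
Proof.
move=> dimL JJ JO.
have lin0 : linear ((fun=> 0) : L -> R^o) by move=> a u v /=; rewrite scaler0 addr0.
have JX X Y : g X (J Y) = - g (J X) Y by rewrite -JO JJ dotNr.
have JXX X : g X (J X) = 0 by have := JX X X; rewrite (dotC _ (J X)); lra.
have [u [uu _ _ _]] := exists_unit_ker dimL lin0 lin0 lin0.
have [v [vv vu vJu _]] := exists_unit_ker dimL (linear_dot u) (linear_dot (J u)) lin0.
exists (nth 0 [:: u; J u; v; J v]); split => //.
have uv : g u v = 0 by rewrite dotC.
have Juv : g (J u) v = 0 by rewrite dotC.
have uJv : g u (J v) = 0 by rewrite JX Juv oppr0.
by apply: orthonormal4P; split; rewrite /= ?JO ?JXX.
Qed.

(** SU(2) acts simply transitively on the unit vectors, and fixes J and the self-dual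
forms of the frame: the frame below consists of u and of its images under the
three complex structures defined by e. *)
Lemma frame_through (J : 'End(L)) e u : \dim {: L} = 4%N ->
  (forall X, J (J X) = - X) -> adapted J e -> g u u = 1 ->
  exists e', [/\ adapted J e', e' 0%N = u &
    forall X, [/\ sdf1 e' X = sdf1 e X, sdf2 e' X = sdf2 e X & sdf3 e' X = sdf3 e X]].
Proof.
move=> dimL JJ [on J0 J2] uu.
have J1 : J (e 1) = - e 0%N by rewrite -J0 JJ.
have J3 : J (e 3) = - e 2%N by rewrite -J2 JJ.
have uE := orthonormal_expand u dimL on.
set a := g u (e 0) in uE; set b := g u (e 1) in uE.
set c := g u (e 2) in uE; set d := g u (e 3) in uE.
have n1 : a ^+ 2 + b ^+ 2 + c ^+ 2 + d ^+ 2 = 1.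
  rewrite -uu {1 2}uE !dotE !on //=; ring.
exists (nth 0 [:: u; a *: e 1%N - b *: e 0%N + c *: e 3%N - d *: e 2%N;
   a *: e 2%N - b *: e 3%N - c *: e 0%N + d *: e 1%N;
   a *: e 3%N + b *: e 2%N - c *: e 1%N - d *: e 0%N]).
split=> //.
- split=> /=.
  + by apply: orthonormal4P; split; rewrite /= ?uE !dotE !on //=; lra.
  + rewrite uE !(linearD, linearB, linearZ) /= J0 J1 J2 J3.
    by apply: (@dot_inj _ _ g) => W; rewrite !dotE; ring.
  + rewrite !(linearD, linearB, linearN, linearZ) /= J0 J1 J2 J3.
    by apply: (@dot_inj _ _ g) => W; rewrite !dotE; ring.
move=> X; rewrite /sdf1 /sdf2 /sdf3 /= uE !(lcDr, lcNr, lcZr) !dotE.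
have z i : g (nabla X (e i)) (e i) = 0 by have := lc_skew X (e i) (e i); lra.
rewrite !z (lc_skew X (e 1) (e 0)) (lc_skew X (e 2) (e 0)) (lc_skew X (e 3) (e 0)).
rewrite (lc_skew X (e 2) (e 1)) (lc_skew X (e 3) (e 1)) (lc_skew X (e 3) (e 2)).
have m1 q : q = (a ^+ 2 + b ^+ 2 + c ^+ 2 + d ^+ 2) * q by rewrite n1 mul1r.
by split; rewrite [RHS]m1; ring.
Qed.

End LeftInvariant.

(** * Gray's condition in an adapted frame *)

Section AdaptedFrames.
Variables (R : realType) (L : lieAlgType R) (g : {dot L for idfun}) (J : 'End(L)).
Hypothesis dimL : \dim {: L} = 4%N.
Hypothesis JJ : forall X, J (J X) = - X.
Hypothesis JO : forall X Y, g (J X) (J Y) = g X Y.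
Implicit Types (X Y Z W : L) (a : R) (e : nat -> L).
Local Notation nabla := (levi_civita g).
Local Notation cv := (curv g).
Local Notation th1 := (sdf1 g).
Local Notation th2 := (sdf2 g).
Local Notation th3 := (sdf3 g).

Lemma dot_expand e X Y : orthonormal4 g e -> g X Y =
  g X (e 0) * g Y (e 0) + g X (e 1) * g Y (e 1) + g X (e 2) * g Y (e 2) + g X (e 3) * g Y (e 3).
Proof.
move=> on; rewrite {1}(orthonormal_expand X dimL on) !dotE.
by rewrite !(dotC _ (e _) Y).
Qed.

Lemma lc_diag e X i : g (nabla X (e i)) (e i) = 0.
Proof. by have := lc_skew g X (e i) (e i); lra. Qed.

(** Rewriting rules expressing the coefficients of nabla_X by those with i < j. *)
Definition lcN e X := (lc_diag e X, lc_skew g X (e 1) (e 0), lc_skew g X (e 2) (e 0),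
  lc_skew g X (e 3) (e 0), lc_skew g X (e 2) (e 1), lc_skew g X (e 3) (e 1),
  lc_skew g X (e 3) (e 2)).

Section Gray.
Hypothesis AH : forall X Y Z W, cv X Y Z W = cv X Y (J Z) (J W).

Lemma adaptedJ e : adapted g J e -> (J (e 1) = - e 0%N) * (J (e 3) = - e 2%N).
Proof. by case=> _ <- <-; rewrite !JJ. Qed.

(** The (e0, e2) instance of Gray's condition. *)
Lemma AH_sdf2 e X Y : adapted g J e ->
  th2 e [< X, Y >] = th3 e X * th1 e Y - th3 e Y * th1 e X.
Proof.
move=> ad; have [on J0 J2] := ad.
have := AH X Y (e 0) (e 2); rewrite J0 J2 !curvE.
rewrite !(dot_expand (nabla _ (e _)) (nabla _ (e _)) on) /sdf1 /sdf2 /sdf3.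
by rewrite !(lcN e X) !(lcN e Y) ?(lcN e [< X, Y >]); lra.
Qed.

(** The (e0, e3) instance of Gray's condition. *)
Lemma AH_sdf3 e X Y : adapted g J e ->
  th3 e [< X, Y >] = th1 e X * th2 e Y - th1 e Y * th2 e X.
Proof.
move=> ad; have [on J0 J2] := ad.
have := AH X Y (e 0) (e 3); rewrite J0 (adaptedJ ad) /curv dotNr -/(cv _ _ _ _) -/(cv _ _ _ _) !curvE.
rewrite !(dot_expand (nabla _ (e _)) (nabla _ (e _)) on) /sdf1 /sdf2 /sdf3.
by rewrite !(lcN e X) !(lcN e Y) ?(lcN e [< X, Y >]); lra.
Qed.

(** The remaining component of the self-dual curvature. *)
Lemma curv_sdf1 e X Y : orthonormal4 g e -> cv X Y (e 0) (e 1) + cv X Y (e 2) (e 3) =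
  th2 e X * th3 e Y - th2 e Y * th3 e X - th1 e [< X, Y >].
Proof.
move=> on; rewrite !curvE.
rewrite !(dot_expand (nabla _ (e _)) (nabla _ (e _)) on) /sdf1 /sdf2 /sdf3.
by rewrite !(lcN e X) !(lcN e Y) ?(lcN e [< X, Y >]); lra.
Qed.

(** By the pair symmetry of the curvature, the two-form P of [curv_sdf1] is
orthogonal to e02 + e31 and to e03 + e12. *)
Lemma AH_type11 e : adapted g J e ->
  let P X Y := th2 e X * th3 e Y - th2 e Y * th3 e X - th1 e [< X, Y >] in
  P (e 0) (e 2) + P (e 3) (e 1) = 0 /\ P (e 0) (e 3) + P (e 1) (e 2) = 0.
Proof.
move=> ad /=; have [on J0 J2] := ad; rewrite -!curv_sdf1 //.
have J1 := adaptedJ ad.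
have s Z W : cv Z W (e 0) (e 2) = cv Z W (e 1) (e 3) by rewrite AH J0 J2.
have t Z W : cv Z W (e 0) (e 3) = - cv Z W (e 1) (e 2).
  by rewrite AH J0 J1 /curv dotNr.
rewrite !(curv_pair g (e 0) (e 2)) !(curv_pair g (e 3) (e 1)).
rewrite !(curv_pair g (e 0) (e 3)) !(curv_pair g (e 1) (e 2)).
rewrite (s (e 0) (e 1)) (s (e 2) (e 3)) (t (e 0) (e 1)) (t (e 2) (e 3)).
rewrite (curv_skewr g _ _ (e 3)) (curv_skewr g (e 2) (e 3) (e 3)); lra.
Qed.

End Gray.

Lemma kahler_of_sdf e : adapted g J e ->
  (forall X, th2 e X = 0 /\ th3 e X = 0) ->
  forall X Y, nabla X (J Y) - J (nabla X Y) = 0.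
Proof.
move=> ad th0 X Y; have [on J0 J2] := ad; have J1 := adaptedJ ad.
apply: (@dot_inj _ _ g) => W; rewrite dotBl dot0l.
have JW U V : g (J U) V = - g U (J V) by rewrite -[in RHS]JO JJ dotNr opprK.
rewrite JW (orthonormal_expand Y dimL on) (orthonormal_expand W dimL on).
rewrite !(linearD, linearZ) /= J0 J2 !J1 !(lcDr, lcZr, lcNr) !dotE !lcN.
have [] := th0 X; rewrite /sdf2 /sdf3 !lcN => h2 h3.
have -> : g (nabla X (e 0)) (e 2) = g (nabla X (e 1)) (e 3) by lra.
have -> : g (nabla X (e 0)) (e 3) = - g (nabla X (e 1)) (e 2) by lra.
by ring.
Qed.

Lemma sdfD e X Y : (th1 e (X + Y) = th1 e X + th1 e Y) * (th2 e (X + Y) = th2 e X + th2 e Y)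
   * (th3 e (X + Y) = th3 e X + th3 e Y).
Proof. by rewrite /sdf1 /sdf2 /sdf3 !lcDl !dotE; split; [split|]; ring. Qed.
Lemma sdfZ e a X : (th1 e (a *: X) = a * th1 e X) * (th2 e (a *: X) = a * th2 e X)
   * (th3 e (a *: X) = a * th3 e X).
Proof. by rewrite /sdf1 /sdf2 /sdf3 !lcZl !dotE; split; [split|]; ring. Qed.

(** The structure constants of L in the frame e. *)
Definition sc e i j k : R := g [< e i, e j >] (e k).

Lemma scC e i j k : sc e i j k = - sc e j i k.
Proof. by rewrite /sc liebrC dotNl. Qed.

Lemma br_expand e i j : orthonormal4 g e -> [< e i, e j >] = sc e i j 0 *: e 0%N
  + sc e i j 1 *: e 1%N + sc e i j 2 *: e 2%N + sc e i j 3 *: e 3%N.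
Proof. exact: orthonormal_expand. Qed.

Lemma sc_jac e i j k m : orthonormal4 g e -> jac (sc e) i j k m = 0.
Proof.
move=> on; have := congr1 (g^~ (e m)) (liebr_jacobi (e i) (e j) (e k)).
rewrite /= (br_expand j k on) (br_expand k i on) (br_expand i j on).
by rewrite !(brDr, brZr) !dotE => <-; rewrite /jac.
Qed.

Lemma sd_sdf e i : (sd1 (sc e) i = th1 e (e i)) * (sd2 (sc e) i = th2 e (e i))
  * (sd3 (sc e) i = th3 e (e i)).
Proof. by rewrite /sdf1 /sdf2 /sdf3 !levi_civitaE. Qed.

Lemma ext_sdf e i j : orthonormal4 g e ->
  [/\ ext (sc e) (sd1 (sc e)) i j = th1 e [< e i, e j >],
      ext (sc e) (sd2 (sc e)) i j = th2 e [< e i, e j >] &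
      ext (sc e) (sd3 (sc e)) i j = th3 e [< e i, e j >]].
Proof. by move=> on; rewrite (br_expand i j on) !(sdfD, sdfZ) /ext !sd_sdf. Qed.

Lemma sdf_expand e e' X : orthonormal4 g e' ->
  [/\ th1 e X = g X (e' 0) * th1 e (e' 0) + g X (e' 1) * th1 e (e' 1)
        + g X (e' 2) * th1 e (e' 2) + g X (e' 3) * th1 e (e' 3),
      th2 e X = g X (e' 0) * th2 e (e' 0) + g X (e' 1) * th2 e (e' 1)
        + g X (e' 2) * th2 e (e' 2) + g X (e' 3) * th2 e (e' 3) &
      th3 e X = g X (e' 0) * th3 e (e' 0) + g X (e' 1) * th3 e (e' 1)
        + g X (e' 2) * th3 e (e' 2) + g X (e' 3) * th3 e (e' 3)].
Proof.
by move=> on; rewrite {1 6 11}(orthonormal_expand X dimL on) !(sdfD, sdfZ).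
Qed.

(** The rotation by a right angle in the plane of e2 and e3. *)
Lemma frame_turn e : adapted g J e -> exists2 e', adapted g J e' &
  forall X, th2 e' X = th3 e X.
Proof.
move=> ad; have [on J0 J2] := ad; have J1 := adaptedJ ad.
exists (nth 0 [:: e 0%N; e 1%N; e 3%N; - e 2%N]).
  split => //=; last by rewrite J1.
  by apply: orthonormal4P; split; rewrite /= ?dotE ?on // ?oppr0 ?opprK.
by move=> X; rewrite /sdf2 /sdf3 /= lcNr dotNl (lc_skew g X (e 2)) opprK.
Qed.

(** A non-Kaehler structure has a frame in which th2 is a nonzero multiple of the
dual of e0. *)
Lemma frame_sdf2 : ~ (forall X Y, nabla X (J Y) - J (nabla X Y) = 0) ->
  exists e, [/\ adapted g J e, th2 e (e 0) != 0 &
    [/\ th2 e (e 1) = 0, th2 e (e 2) = 0 & th2 e (e 3) = 0]].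
Proof.
move=> nK.
have z e e' : orthonormal4 g e' -> [&& th2 e (e' 0) == 0, th2 e (e' 1) == 0,
    th2 e (e' 2) == 0 & th2 e (e' 3) == 0] -> forall X, th2 e X = 0.
  move=> on /and4P[/eqP h0 /eqP h1 /eqP h2 /eqP h3] X.
  by have [_ -> _] := sdf_expand e X on; rewrite h0 h1 h2 h3 !mulr0 !addr0.
(* Either th2 or th3 is nonzero, and a turn of the frame exchanges them. *)
have [e ad nz] : exists2 e, adapted g J e & ~ forall X, th2 e X = 0.
  have [e ad] := adapted_exists dimL JJ JO; have [on _ _] := ad.
  have [e' ad' e'E] := frame_turn ad; have [on' _ _] := ad'.
  have [h|h] := boolP [&& th2 e (e 0) == 0, th2 e (e 1) == 0,
    th2 e (e 2) == 0 & th2 e (e 3) == 0].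
    exists e' => // h'; apply: nK; apply: (kahler_of_sdf ad) => X.
    by rewrite -e'E h' (z _ _ on h).
  by exists e => // h'; move: h; rewrite !h' eqxx.
have [on J0 J2] := ad.
(* The vector dual to th2. *)
pose v := th2 e (e 0) *: e 0%N + th2 e (e 1) *: e 1%N + th2 e (e 2) *: e 2%N
  + th2 e (e 3) *: e 3%N.
have vE X : th2 e X = g v X.
  have [_ -> _] := sdf_expand e X on.
  by rewrite /v !dotE !(dotC _ (e _) X); ring.
have v0 : v != 0.
  by apply/eqP => v0; apply: nz => X; rewrite vE v0 dot0l.
have [a a0 av] := unit_scale g v0.
have [e' [ad' e'0 e'E]] := frame_through dimL JJ ad av.
have [on' _ _] := ad'.
have e'v X : th2 e' X = a^-1 * g (e' 0) X.
  by have [_ -> _] := e'E X; rewrite vE e'0 dotZl mulKf.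
by exists e'; split=> //; rewrite ?e'v !on' //= ?mulr0 ?mulr1 ?invr_neq0.
Qed.

(** * Independent th2 and th3 *)

Section Independent.
Hypothesis AH : forall X Y Z W, cv X Y Z W = cv X Y (J Z) (J W).

(** The two-form t(X, Y) = th1 [X, Y] satisfies th2 /\ t = th3 /\ t = 0. *)
Lemma dsdf1_decomposable e V W : adapted g J e ->
  th2 e V * th3 e W - th2 e W * th3 e V != 0 ->
  exists k, forall X Y, th1 e [< X, Y >] = k * (th2 e X * th3 e Y - th2 e Y * th3 e X).
Proof.
move=> ad; set d := _ - _ => d0.
have c2 X Y Z : th3 e X * th1 e [< Y, Z >] + th3 e Y * th1 e [< Z, X >]
    + th3 e Z * th1 e [< X, Y >] = 0.
  have := (congr1 (th2 e) (liebr_jacobi X Y Z)).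
  rewrite !sdfD !(AH_sdf2 AH _ _ ad) !(AH_sdf3 AH _ _ ad).
  have -> : th2 e 0 = 0 by rewrite -[0 in LHS](scale0r X) sdfZ mul0r.
  by lra.
have c3 X Y Z : th2 e X * th1 e [< Y, Z >] + th2 e Y * th1 e [< Z, X >]
    + th2 e Z * th1 e [< X, Y >] = 0.
  have := (congr1 (th3 e) (liebr_jacobi X Y Z)).
  rewrite !sdfD !(AH_sdf3 AH _ _ ad) !(AH_sdf2 AH _ _ ad).
  have -> : th3 e 0 = 0 by rewrite -[0 in LHS](scale0r X) sdfZ mul0r.
  by lra.
have s X Y : th1 e [< X, Y >] = - th1 e [< Y, X >].
  by rewrite liebrC -scaleN1r sdfZ mulN1r.
exists (th1 e [< V, W >] / d) => X Y.
apply: (mulfI d0); rewrite mulrA mulrCA divff // mulr1.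
(* Contract th2 /\ t and th3 /\ t with V and W. *)
have -> : d * th1 e [< X, Y >] = th3 e W * (th2 e V * th1 e [< X, Y >]
    + th2 e X * th1 e [< Y, V >] + th2 e Y * th1 e [< V, X >])
  - th3 e V * (th2 e W * th1 e [< X, Y >]
    + th2 e X * th1 e [< Y, W >] + th2 e Y * th1 e [< W, X >])
  - th2 e X * (th3 e V * th1 e [< W, Y >] + th3 e W * th1 e [< Y, V >]
    + th3 e Y * th1 e [< V, W >])
  + th2 e Y * (th3 e V * th1 e [< W, X >] + th3 e W * th1 e [< X, V >]
    + th3 e X * th1 e [< V, W >])
  + th1 e [< V, W >] * (th2 e X * th3 e Y - th2 e Y * th3 e X).
  by rewrite (s W Y) (s X V) /d; ring.
by rewrite !c2 !c3; ring.
Qed.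

(** Gray's condition makes th3 proportional to th2. *)
Lemma rank1_of_normalized e : adapted g J e -> th2 e (e 0) != 0 ->
  [/\ th2 e (e 1) = 0, th2 e (e 2) = 0 & th2 e (e 3) = 0] ->
  [/\ th3 e (e 1) = 0, th3 e (e 2) = 0 & th3 e (e 3) = 0].
Proof.
move=> ad p0 [z1 z2 z3]; have [on J0 J2] := ad.
have cC := @scC e; have cJ i j k m := sc_jac i j k m on.
have F1 k (h : forall X Y, th1 e [< X, Y >] = k * (th2 e X * th3 e Y - th2 e Y * th3 e X))
    f : adapted g J f -> (forall X, [/\ th1 f X = th1 e X, th2 f X = th2 e X & th3 f X = th3 e X]) ->
    forall i j, ext (sc f) (sd1 (sc f)) i j = k * wedge (sd2 (sc f)) (sd3 (sc f)) i j.
  move=> [onf _ _] fE i j; have [-> _ _] := ext_sdf i j onf.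
  rewrite /wedge !sd_sdf; have [-> _ _] := fE [< f i, f j >].
  by have [_ -> ->] := fE (f i); have [_ -> ->] := fE (f j); rewrite h.
have F2 f : adapted g J f ->
    forall i j, ext (sc f) (sd2 (sc f)) i j = wedge (sd3 (sc f)) (sd1 (sc f)) i j.
  move=> adf i j; have [onf _ _] := adf; have [_ -> _] := ext_sdf i j onf.
  by rewrite /wedge !sd_sdf (AH_sdf2 AH _ _ adf).
have F3 f : adapted g J f ->
    forall i j, ext (sc f) (sd3 (sc f)) i j = wedge (sd1 (sc f)) (sd2 (sc f)) i j.
  move=> adf i j; have [onf _ _] := adf; have [_ _ ->] := ext_sdf i j onf.
  by rewrite /wedge !sd_sdf (AH_sdf3 AH _ _ adf).
have [/and3P[/eqP-> /eqP-> /eqP->] //|nz] :=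
  boolP [&& th3 e (e 1) == 0, th3 e (e 2) == 0 & th3 e (e 3) == 0].
exfalso.
have [V dV] : exists V, th2 e (e 0) * th3 e V - th2 e V * th3 e (e 0) != 0.
  move: nz; rewrite !negb_and => /or3P[] y0; [exists (e 1%N)|exists (e 2%N)|exists (e 3%N)].
  - by rewrite z1 mul0r subr0 mulf_neq0.
  - by rewrite z2 mul0r subr0 mulf_neq0.
  - by rewrite z3 mul0r subr0 mulf_neq0.
have [k kE] := dsdf1_decomposable ad dV.
have eE X : [/\ th1 e X = th1 e X, th2 e X = th2 e X & th3 e X = th3 e X] by [].
(* If k <> 1 then th3 has no component along e2, e3, as th2 /\ th3 has type (1,1). *)
have [/eqP k1|k1] := boolP (k == 1); last first.
  have [t1 t2] := AH_type11 AH ad.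
  move: t1 t2; rewrite !kE z1 z2 z3 => t1 t2.
  have k10 : (1 - k) * th2 e (e 0) != 0 by rewrite mulf_neq0 // subr_eq0 eq_sym.
  have y2 : th3 e (e 2) = 0 by apply: (mulfI k10); lra.
  have y3 : th3 e (e 3) = 0 by apply: (mulfI k10); lra.
  move: nz; rewrite y2 y3 eqxx andbT => /negP; apply; rewrite andbT.
  have := no_line cC cJ (F1 k kE e ad eE) (F2 e ad) (F3 e ad).
  rewrite !sd_sdf => /(_ z1 z2 z3 y2 y3) /eqP.
  by rewrite mulf_eq0 (negPf p0).
(* The flat case: use a frame whose first vector is killed by th1, th2, th3. *)
have lin h : (forall X Y, h (X + Y) = h X + h Y) -> (forall a X, h (a *: X) = a * h X) ->
    linear (h : L -> R^o).
  by move=> hD hZ a X Y; rewrite hD hZ.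
have [u [uu u1 u2 u3]] := exists_unit_ker g dimL
  (lin (th1 e) (fun X Y => (sdfD e X Y).1.1) (fun a X => (sdfZ e a X).1.1))
  (lin (th2 e) (fun X Y => (sdfD e X Y).1.2) (fun a X => (sdfZ e a X).1.2))
  (lin (th3 e) (fun X Y => (sdfD e X Y).2) (fun a X => (sdfZ e a X).2)).
have [f [adf f0 fE]] := frame_through dimL JJ ad uu; have [onf _ _] := adf.
have G1 i j : ext (sc f) (sd1 (sc f)) i j = wedge (sd2 (sc f)) (sd3 (sc f)) i j.
  by rewrite (F1 k kE f adf fE) k1 mul1r.
have := no_flat (@scC f) (fun i j k m => sc_jac i j k m onf) G1 (F2 f adf) (F3 f adf).
rewrite /wedge !sd_sdf f0.
have [-> -> ->] := fE u; case/(_ u1 u2 u3).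
have [_ -> ->] := fE (f 1%N); have [_ -> ->] := fE (f 2%N); have [_ -> ->] := fE (f 3%N).
move=> w23 w31 w12; move/eqP: dV; apply.
have [_ -> ->] := sdf_expand e V onf; have [_ -> ->] := sdf_expand e (e 0) onf.
rewrite f0 u2 u3; set p := g (e 0); set q := g V.
transitivity ((p (f 2%N) * q (f 3%N) - p (f 3%N) * q (f 2%N))
    * (th2 e (f 2) * th3 e (f 3) - th2 e (f 3) * th3 e (f 2))
  + (p (f 3%N) * q (f 1%N) - p (f 1%N) * q (f 3%N))
    * (th2 e (f 3) * th3 e (f 1) - th2 e (f 1) * th3 e (f 3))
  + (p (f 1%N) * q (f 2%N) - p (f 2%N) * q (f 1%N))
    * (th2 e (f 1) * th3 e (f 2) - th2 e (f 2) * th3 e (f 1))); first ring.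
by rewrite w23 w31 w12 !mulr0 !addr0.
Qed.

End Independent.

(** * Proportional th2 and th3 *)

(** The Lie algebra is then the semidirect product of R e0 and the abelian ideal
spanned by e1, e2, e3, on which ad e0 is the cross product with (n1, n2, n3). *)
Lemma rank1_brackets e : orthonormal4 g e ->
  (forall X Y, th2 e [< X, Y >] = th3 e X * th1 e Y - th3 e Y * th1 e X) ->
  (forall X Y, th3 e [< X, Y >] = th1 e X * th2 e Y - th1 e Y * th2 e X) ->
  th2 e (e 0) != 0 ->
  [/\ th2 e (e 1) = 0, th2 e (e 2) = 0 & th2 e (e 3) = 0] ->
  [/\ th3 e (e 1) = 0, th3 e (e 2) = 0 & th3 e (e 3) = 0] ->
  exists n1 n2 n3, [/\ n2 != 0, [< e 0, e 1 >] = n3 *: e 2%N - n2 *: e 3%N,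
    [< e 0, e 2 >] = n1 *: e 3%N - n3 *: e 1%N, [< e 0, e 3 >] = n2 *: e 1%N - n1 *: e 2%N &
    [/\ [< e 1, e 2 >] = 0, [< e 2, e 3 >] = 0 & [< e 3, e 1 >] = 0]].
Proof.
move=> on F2 F3 p0 [y1 y2 y3] [z1 z2 z3].
set p := th2 e (e 0) in p0; set x := th3 e (e 0).
have E2 X : th2 e X = p * g X (e 0).
  by have [_ -> _] := sdf_expand e X on; rewrite y1 y2 y3 -/p; ring.
have E3 X : th3 e X = x * g X (e 0).
  by have [_ _ ->] := sdf_expand e X on; rewrite z1 z2 z3 -/x; ring.
(* With th2 = p e^0 and th3 = x e^0, comparing the two Gray equations on (e0, X)
   gives (x^2 + p^2) th1 X = 0 for X orthogonal to e0. *)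
have w X : g X (e 0) = 0 -> th1 e X = 0.
  move=> X0; have := F2 (e 0) X; have := F3 (e 0) X.
  rewrite !E2 !E3 !on // X0 /= => h3 h2.
  have pos : x ^+ 2 + p ^+ 2 != 0.
    by rewrite gt_eqF // ltr_wpDl ?sqr_ge0 // exprn_even_gt0.
  apply: (mulfI pos).
  have k3 : p * (x * g [< e 0, X >] (e 0)) = p * - (p * th1 e X) by rewrite h3; ring.
  have k2 : x * (p * g [< e 0, X >] (e 0)) = x * (x * th1 e X) by rewrite h2; ring.
  lra.
have [t1 t2 t3] : [/\ th1 e (e 1) = 0, th1 e (e 2) = 0 & th1 e (e 3) = 0].
  by split; apply: w; rewrite on.
have E1 X : th1 e X = th1 e (e 0) * g X (e 0).
  by have [-> _ _] := sdf_expand e X on; rewrite t1 t2 t3; ring.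
have c0 i j : sc e i j 0 = 0.
  by apply: (mulfI p0); rewrite mulr0 /sc -(E2 [< e i, e j >]) F2 !E3 (E1 (e i)) (E1 (e j)); ring.
have [] := rank1_abelian (@scC e) (fun i j k m => sc_jac i j k m on) c0.
  by case=> [|[|[|[|]]]] // _; rewrite !sd_sdf; split.
move=> ab [d1 d2 d3] [s21 s32 s13].
exists (sc e 0 2 3), (sc e 0 3 1), (sc e 0 1 2); split.
- have := sd_sdf e 0 => -[[_ h2] _]; move: p0; rewrite /p -h2 /sd2 /conn.
  rewrite !(cN (@scC e)) !c0 s13; apply: contra => /eqP ->; apply/eqP; lra.
- by rewrite (br_expand 0 1 on) c0 d1 s13 !scale0r !add0r scaleNr.
- by rewrite (br_expand 0 2 on) c0 d2 s21 !scale0r !add0r addr0 scaleNr addrC.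
- by rewrite (br_expand 0 3 on) c0 d3 s32 !scale0r !add0r addr0 scaleNr.
have [A0 B0 C0] := ab 0 isT; have [A1 B1 C1] := ab 1 isT.
have [A2 B2 C2] := ab 2 isT; have [A3 B3 C3] := ab 3 isT.
split; rewrite (br_expand _ _ on).
- by rewrite A0 A1 A2 A3 !scale0r !addr0.
- by rewrite B0 B1 B2 B3 !scale0r !addr0.
- by rewrite C0 C1 C2 C3 !scale0r !addr0.
Qed.

End AdaptedFrames.

(** * A rotation acting on an abelian ideal *)

Section Rotation.
Variables (R : realType) (L : lieAlgType R) (g : {dot L for idfun}).
Implicit Types (X Y Z W : L) (a : R) (e : nat -> L).
Local Notation nabla := (levi_civita g).

(** For a unit vector u: the orthogonal complement of u is an abelian ideal, and
ad u is skew. *)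
Definition rotational (u : L) :=
  (forall X Y, [< X, Y >] = g X u *: [< u, Y >] - g Y u *: [< u, X >]) /\
  (forall X Y, g [< u, X >] Y = - g X [< u, Y >]).

Lemma rotational_lc u : rotational u ->
  forall X Y, nabla X Y = g X u *: [< u, Y >].
Proof.
case=> brE sk X Y; apply/esym/(levi_civita_unique (nabla := fun X Y => g X u *: [< u, Y >])).
- by move=> {}X {}Y; rewrite -brE.
- by move=> {}X {}Y Z; rewrite dotZl dotZr sk; ring.
Qed.

Lemma rotational_flat u : rotational u -> flat g.
Proof.
move=> ru; have [brE sk] := ru; have lcE := rotational_lc ru.
move=> X Y Z; rewrite /riemann !lcE !brZr.
have -> : g [< X, Y >] u = 0.
  by rewrite brE dotBl !dotZl !sk liebrxx !dot0r; ring.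
by rewrite scale0r subr0 !scalerA [g Y u * _]mulrC subrr.
Qed.

Lemma flat_AH1 (S : almost_hermitian L) : flat (ah_metric S) -> AH1 S.
Proof. by move=> fl X Y Z W; rewrite /curv !fl !dot0l. Qed.

(** The isomorphism sends e1, e2, e0 / k, e3 to the canonical basis. *)
Lemma rotational_iso e k : \dim {: L} = 4%N -> orthonormal4 g e -> rotational (e 0) -> k != 0 ->
  [< e 0, e 1 >] = k *: e 2%N -> [< e 0, e 2 >] = - k *: e 1%N -> [< e 0, e 3 >] = 0 ->
  lie_isomorphic L (A36A1 R).
Proof.
move=> dimL on [brE sk] k0 b1 b2 b3.
pose F X : 'rV[R]_4 := \row_(i < 4) [:: g X (e 1); g X (e 2); k * g X (e 0); g X (e 3)]`_i.
have lF : linear (F : L -> A36A1 R).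
  move=> a u v; apply/rowP => -[[|[|[|[|]]]] // lt]; rewrite !mxE /= !dotE //; ring.
pose f : {linear L -> A36A1 R} := HB.pack (F : L -> A36A1 R) (GRing.isLinear.Build _ _ _ _ _ lF).
pose h (v : 'rV[R]_4) : L := (v 0 (inord 2) / k) *: e 0%N + v 0 (inord 0) *: e 1%N
  + v 0 (inord 1) *: e 2%N + v 0 (inord 3) *: e 3%N.
exists f; split.
  exists h => [X|v].
    rewrite [RHS](orthonormal_expand X dimL on) /h !mxE !inordK //=.
    by rewrite [k * _]mulrC mulfK.
  apply/rowP => j; rewrite mxE /h !dotE !on //= !(mulr0, mulr1, addr0, add0r).
  rewrite mulrCA divff // mulr1.
  by case: j => [[|[|[|[|]]]]] // lt /=; congr (v _ _); apply: val_inj; rewrite /= inordK.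
move=> X Y; have gbr i : g [< X, Y >] (e i) = - g X (e 0) * g Y [< e 0, e i >]
    + g Y (e 0) * g X [< e 0, e i >].
  by rewrite brE dotBl !dotZl !sk; ring.
apply/rowP => j; rewrite [in RHS]/liebr /= !mxE -!val_eqE /= !inordK //=.
by case: j => [[|[|[|[|]]]]] // lt /=; rewrite !gbr ?liebrxx ?b1 ?b2 ?b3 !dotE; ring.
Qed.

Lemma rotational_of_sc e n1 n2 n3 : \dim {: L} = 4%N -> orthonormal4 g e ->
  [< e 0, e 1 >] = n3 *: e 2%N - n2 *: e 3%N ->
  [< e 0, e 2 >] = n1 *: e 3%N - n3 *: e 1%N ->
  [< e 0, e 3 >] = n2 *: e 1%N - n1 *: e 2%N ->
  [/\ [< e 1, e 2 >] = 0, [< e 2, e 3 >] = 0 & [< e 3, e 1 >] = 0] ->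
  rotational (e 0).
Proof.
move=> dimL on b1 b2 b3 [b12 b23 b31].
have b13 : [< e 1, e 3 >] = 0 by rewrite liebrC b31 oppr0.
have b21 : [< e 2, e 1 >] = 0 by rewrite liebrC b12 oppr0.
have b32 : [< e 3, e 2 >] = 0 by rewrite liebrC b23 oppr0.
have uE X : [< e 0, X >] = (n2 * g X (e 3) - n3 * g X (e 2)) *: e 1%N
    + (n3 * g X (e 1) - n1 * g X (e 3)) *: e 2%N + (n1 * g X (e 2) - n2 * g X (e 1)) *: e 3%N.
  rewrite {1}(orthonormal_expand X dimL on) !(brDr, brZr) liebrxx b1 b2 b3.
  by apply: (@dot_inj _ _ g) => W; rewrite !dotE; ring.
split=> [X Y|X Y]; last first.
  by rewrite !uE !dotE !(dotC _ (e _)); ring.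
rewrite {1}(orthonormal_expand X dimL on) !(brDl, brZl).
rewrite [ [< e 1, Y >] ](_ : _ = - g Y (e 0) *: [< e 0, e 1 >]); last first.
  rewrite {1}(orthonormal_expand Y dimL on) !(brDr, brZr) liebrxx b12 b13.
  by rewrite (liebrC (e 1)) !scaler0 !addr0 scalerN scaleNr.
rewrite [ [< e 2, Y >] ](_ : _ = - g Y (e 0) *: [< e 0, e 2 >]); last first.
  rewrite {1}(orthonormal_expand Y dimL on) !(brDr, brZr) liebrxx b21 b23.
  by rewrite (liebrC (e 2)) !scaler0 !addr0 scalerN scaleNr.
rewrite [ [< e 3, Y >] ](_ : _ = - g Y (e 0) *: [< e 0, e 3 >]); last first.
  rewrite {1}(orthonormal_expand Y dimL on) !(brDr, brZr) liebrxx b31 b32.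
  by rewrite (liebrC (e 3)) !scaler0 !addr0 scalerN scaleNr.
rewrite b1 b2 b3 (uE X).
by apply: (@dot_inj _ _ g) => W; rewrite !dotE; ring.
Qed.

(** Replace e1, e2, e3 by an orthonormal basis f1, f2, f3 with f3 along the axis
n = (n1, n2, n3), f1 along (0, n3, - n2) and f2 = n x f1 / |n|. *)
Lemma iso_of_axis e n1 n2 n3 : \dim {: L} = 4%N -> orthonormal4 g e -> n2 != 0 -> rotational (e 0) ->
  [< e 0, e 1 >] = n3 *: e 2%N - n2 *: e 3%N ->
  [< e 0, e 2 >] = n1 *: e 3%N - n3 *: e 1%N ->
  [< e 0, e 3 >] = n2 *: e 1%N - n1 *: e 2%N ->
  lie_isomorphic L (A36A1 R).
Proof.
move=> dimL on n0 ru b1 b2 b3.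
pose Q := n2 ^+ 2 + n3 ^+ 2; pose K := n1 ^+ 2 + Q.
have Q0 : 0 < Q by rewrite ltr_pwDl ?sqr_ge0 // exprn_even_gt0.
have K0 : 0 < K by rewrite ltr_wpDl ?sqr_ge0.
pose q := (Num.sqrt Q)^-1; pose k := Num.sqrt K.
have qQ : q ^+ 2 * Q = 1 by rewrite exprVn sqr_sqrtr ?ltW // mulVf ?gt_eqF.
have kK : k ^+ 2 = K by rewrite sqr_sqrtr // ltW.
have k0 : k != 0 by rewrite sqrtr_eq0 -ltNge.
have kV : k^-1 ^+ 2 * K = 1 by rewrite exprVn kK mulVf ?gt_eqF.
clearbody q k.
pose f1 := (q * n3) *: e 2%N - (q * n2) *: e 3%N.
pose f2 := (k^-1 * q) *: ((- Q) *: e 1%N + (n1 * n2) *: e 2%N + (n1 * n3) *: e 3%N).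
pose f3 := k^-1 *: (n1 *: e 1%N + n2 *: e 2%N + n3 *: e 3%N).
apply: (@rotational_iso (nth 0 [:: e 0%N; f1; f2; f3]) k) => //=.
- apply: orthonormal4P; split; rewrite /= /f1 /f2 /f3 ?dotE ?on //= ?mulr0 ?subr0 ?addr0 //.
  + by transitivity (q ^+ 2 * Q); [rewrite /Q; ring|].
  + transitivity (q ^+ 2 * Q * (k^-1 ^+ 2 * K)); first by rewrite /K /Q; ring.
    by rewrite qQ kV mulr1.
  + by transitivity (k^-1 ^+ 2 * K); [rewrite /K /Q; ring|].
  + by rewrite /Q; ring.
  + by rewrite /Q; ring.
  + by rewrite /Q; ring.
  + by ring.
  + by rewrite /Q; ring.
- rewrite /f1 brBr !brZr b2 b3 /f2 scalerA mulrA divff // mul1r /Q.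
  by apply: (@dot_inj _ _ g) => W; rewrite !dotE; ring.
- rewrite /f2 brZr !brDr !brZr b1 b2 b3 /f1.
  have kE : k = k^-1 * K by rewrite -kK expr2 mulKf.
  rewrite [in RHS]kE.
  by apply: (@dot_inj _ _ g) => W; rewrite !dotE /K /Q; ring.
rewrite /f3 brZr !brDr !brZr b1 b2 b3.
by apply: (@dot_inj _ _ g) => W; rewrite !dotE; ring.
Qed.

End Rotation.

(** * A flat non-Kaehler structure on A_{3,6} + A_1 *)

Section Example.
Variable R : realType.
Local Notation V := (A36A1 R).

(** The metric for which the canonical basis is orthonormal. *)
Definition std_dot (u v : V) : R := \sum_(i < 4) (u : 'rV[R]_4) 0 i * (v : 'rV[R]_4) 0 i.

Lemma std_dotC u v : std_dot u v = std_dot v u.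
Proof. by apply: eq_bigr => i _; rewrite mulrC. Qed.

Lemma std_dot_linear u : linear (std_dot u : V -> R^o).
Proof.
move=> a v w; rewrite /std_dot scaler_sumr -big_split /=.
by apply: eq_bigr => i _; rewrite !mxE /GRing.scale /=; ring.
Qed.

Lemma std_dot_linearl u : linear (std_dot^~ u : V -> R^o).
Proof. by move=> a v w; rewrite !(std_dotC _ u) std_dot_linear. Qed.

HB.instance Definition _ := bilinear_isBilinear.Build R V V R *%R (idfun \; *%R) std_dot
  (std_dot_linearl, std_dot_linear).

Lemma std_dot_sym u v : std_dot u v = (-1) ^+ false * idfun (std_dot v u).
Proof. by rewrite expr0 mul1r /= std_dotC. Qed.

HB.instance Definition _ := isHermitianSesquilinear.Build R V false idfun std_dot std_dot_sym.

Lemma std_dot_gt0 u : u != 0 -> 0 < std_dot u u.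
Proof.
move=> u0; rewrite lt_def sumr_ge0 ?andbT => [|i _]; last by rewrite -expr2 sqr_ge0.
apply: contra u0; rewrite psumr_eq0 => [/allP h|i _]; last by rewrite -expr2 sqr_ge0.
apply/eqP/rowP => i; have /implyP := h i (mem_index_enum _).
by rewrite mxE -expr2 sqrf_eq0 => /(_ isT) /eqP.
Qed.

HB.instance Definition _ := isDotProduct.Build R V std_dot std_dot_gt0.
Definition std_metric : {dot V for idfun} := std_dot.

(** The almost complex structure with J e_1 = e_3 and J e_2 = e_4. *)
Definition std_J_fun (u : V) : V :=
  \row_(i < 4) [:: - (u : 'rV[R]_4) 0 (inord 2); - (u : 'rV[R]_4) 0 (inord 3);
    (u : 'rV[R]_4) 0 (inord 0); (u : 'rV[R]_4) 0 (inord 1)]`_i.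

Lemma std_J_linear : linear std_J_fun.
Proof.
move=> a u v; apply/rowP => -[[|[|[|[|]]]] // lt]; rewrite !mxE //= ; ring.
Qed.

HB.instance Definition _ := GRing.isLinear.Build R V V *:%R std_J_fun std_J_linear.

Definition std_J : 'End(V) := linfun std_J_fun.

Lemma std_JJ u : std_J (std_J u) = - u.
Proof.
rewrite !lfunE; apply/rowP => -[[|[|[|[|]]]] // lt]; rewrite !mxE /= !inordK //=;
  congr (- (u : 'rV[R]_4) _ _); apply: val_inj; rewrite /= inordK //.
Qed.

Lemma std_dotE (u v : V) : std_metric u v =
  (u : 'rV[R]_4) 0 (inord 0) * (v : 'rV[R]_4) 0 (inord 0)
  + (u : 'rV[R]_4) 0 (inord 1) * (v : 'rV[R]_4) 0 (inord 1)
  + (u : 'rV[R]_4) 0 (inord 2) * (v : 'rV[R]_4) 0 (inord 2)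
  + (u : 'rV[R]_4) 0 (inord 3) * (v : 'rV[R]_4) 0 (inord 3).
Proof.
rewrite /std_metric /= /std_dot !big_ord_recl big_ord0 addr0 !addrA.
by congr (_ * _ + _ * _ + _ * _ + _ * _); congr (_ _ _); apply: val_inj; rewrite /= inordK.
Qed.

Lemma std_J_orthogonal u v : std_metric (std_J u) (std_J v) = std_metric u v.
Proof. by rewrite !std_dotE !lfunE !mxE !inordK //=; ring. Qed.

Definition std_ah : almost_hermitian V :=
  @AlmostHermitian R V std_metric std_J (fun X Y => std_metric (std_J X) Y) std_JJ std_J_orthogonal
    (fun X Y => erefl).

(* The third basis vector, which acts by a rotation on the first two. *)
Let r : V := delta_mx 0 (inord 2).

Lemma std_rotational : rotational std_metric r.
Proof.
split=> X Y.
  apply/rowP => i; rewrite /liebr /= !std_dotE /A36A1_br !mxE -!val_eqE /= !inordK //=; ring.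
rewrite !std_dotE /liebr /= !mxE -!val_eqE /= !inordK //=; ring.
Qed.

Lemma std_not_kahler : ~ kahler std_ah.
Proof.
(* The fourth component of (nabla J) applied to e_3 and e_1. *)
move=> /(_ r (delta_mx 0 (inord 0) : V)) /rowP /(_ (inord 3)).
rewrite !(rotational_lc std_rotational) /= !lfunE !mxE /= !inordK //= std_dotE !mxE.
rewrite -!val_eqE /= !inordK //=.
by lra.
Qed.

End Example.

Theorem theorem6p1 (R : realType) :
  (exists S : almost_hermitian (A36A1 R),
     [/\ flat (ah_metric S), AH1 S & ~ kahler S]) /\
  (forall L : lieAlgType R, \dim {: L} = 4%N ->
   forall S : almost_hermitian L, ~ kahler S ->
     (AH1 S <-> lie_isomorphic L (A36A1 R) /\ flat (ah_metric S))).
Proof.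
split.
  exists (std_ah R); split.
  - exact: rotational_flat (std_rotational R).
  - exact/flat_AH1/(rotational_flat (std_rotational R)).
  - exact: std_not_kahler.
move=> L dimL S nK; split=> [AH|[_ fl]]; last exact: flat_AH1.
have [e [ad p0 y]] := frame_sdf2 dimL (@ah_JJ _ _ S) (@ah_orthogonal _ _ S) nK.
have z := rank1_of_normalized dimL (@ah_JJ _ _ S) AH ad p0 y.
have [on _ _] := ad.
have [n1 [n2 [n3 [n20 b1 b2 b3 b0]]]] := rank1_brackets dimL on
  (fun X Y => AH_sdf2 dimL AH X Y ad)
  (fun X Y => AH_sdf3 dimL (@ah_JJ _ _ S) AH X Y ad) p0 y z.
have ru := rotational_of_sc dimL on b1 b2 b3 b0.
split; last exact: rotational_flat ru.
exact: (iso_of_axis dimL on n20 ru b1 b2 b3).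
Qed.
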